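(* For every $\alpha>0$ there exists an integer $n_0$ such that every $3$-uniform hypergraph $H$ with $n\ge n_0$ vertices and with minimum pair-degree $\delta_2(H)\ge \left(\frac45+\alpha\right)n$ contains a squared Hamiltonian cycle.
   Context: A $3$-uniform hypergraph $H=(V,E)$ consists of a finite vertex set $V$ and a family $E$ of $3$-element subsets of $V$ (edges). For distinct $u,v\in V$ the pair-degree $d_H(u,v)$ is the number of edges containing both $u$ and $v$, and $\delta_2(H)$ is the minimum of $d_H(u,v)$ over all pairs of distinct vertices. An $n$-vertex hypergraph $H$ ($n\geq 5$) contains a squared Hamiltonian cycle if all its vertices can be arranged on a circle (each exactly once) in such a way that every triple of vertices contained in a set of four cyclically consecutive vertices is an edge of $H$. *)

(* Defs.v *)
From mathcomp Require Import all_boot all_order all_algebra.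
From mathcomp Require Import reals.

Set Implicit Arguments.
Unset Strict Implicit.
Unset Printing Implicit Defensive.

Record hypergraph3 (V : finType) := Hypergraph3 {
  edges : {set {set V}};
  edges_card3 : forall e : {set V}, e \in edges -> #|e| = 3
}.

Definition pair_degree (V : finType) (H : hypergraph3 V) (u v : V) : nat :=
  #|[set e in edges H | (u \in e) && (v \in e)]|.

(* The default value #|V| exceeds every pair-degree (which is at most #|V| - 2),
   so this is the true minimum as soon as there are two distinct vertices. *)
Definition min_pair_degree (V : finType) (H : hypergraph3 V) : nat :=
  \big[minn/#|V|]_(p : V * V | p.1 != p.2) pair_degree H p.1 p.2.

(* The sequence s lists the vertices in their order around the circle; the sets
   of four cyclically consecutive vertices are the first four entries of its
   rotations. *)
Definition squared_Hamiltonian_cycle (V : finType) (H : hypergraph3 V)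
    (s : seq V) : Prop :=
  [/\ uniq s,
      forall v : V, v \in s
    & forall (i : nat) (e : {set V}), i < size s ->
        #|e| = 3 -> e \subset [set x in take 4 (rot i s)] -> e \in edges H].

Definition has_squared_Hamiltonian_cycle (V : finType) (H : hypergraph3 V)
    : Prop :=
  5 <= #|V| /\ exists s : seq V, squared_Hamiltonian_cycle H s.

(* Main.v *)
(* A squared path is grown at its front.  First it collects short absorbers so that
   every vertex v is absorbed by linearly many of them: a 6-tuple abcdef absorbs v when
   both abcdef and abcvdef are squared paths.  Then it swallows tiles (long squared paths
   inside blow-ups of K_4^(3)) until the set U of unused vertices is small; finally it is
   closed to a cycle through U, and the rest of U is inserted into the absorbers.

   Connectors and absorbers come from patterns whose vertices can be chosen one after the
   other, each subject to at most five pair conditions; as each condition excludes less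
   than a fifth of the vertices, there are linearly many choices at each step, and a
   repeated vertex of a walk is split into distinct ones by passing to a blow-up.

   No random choices and no regularity lemma are needed: absorbers and tiles are picked
   greedily by averaging against exponential potentials.  For the tiles the potential is
   the sum of exp (- K |N(u,v) n U| / |U|) over all pairs u, v; keeping it under control
   preserves the relative minimum pair-degree of U, because for every weight on U there is
   a tile which is essentially not heavier than the average. *)

Require Import Defs.
From mathcomp Require Import all_boot all_order all_algebra.
From mathcomp Require Import reals.
From mathcomp Require Import sequences exp.
From mathcomp Require Import zify ring lra.
Import Order.TTheory GRing.Theory Num.Theory.
Local Open Scope ring_scope.

Set Implicit Arguments.
Unset Strict Implicit.
Unset Printing Implicit Defensive.

(** * Blow-ups in dense relations *)

Lemma sum_card_exchange (S T : finType) (r : S -> T -> bool) (A : pred S) :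
  (\sum_(s | A s) #|[set x | r s x]| = \sum_x #|[set s | A s & r s x]|)%N.
Proof.
under eq_bigr do rewrite -sum1dep_card big_mkcond.
under [RHS]eq_bigr do rewrite -sum1dep_card big_mkcondr.
exact: exchange_big.
Qed.

Lemma card_tuple_cons (V : finType) k (P : pred (seq V)) :
  (#|[set s : k.+1.-tuple V | P s]| =
   \sum_(x : V) #|[set s : k.-tuple V | P (x :: s)]|)%N.
Proof.
rewrite -sum1dep_card.
under [RHS]eq_bigr do rewrite -sum1dep_card.
rewrite pair_big_dep /=.
rewrite (reindex (fun p : V * k.-tuple V => [tuple of p.1 :: p.2])) //=.
exists (fun s : k.+1.-tuple V => (thead s, [tuple of behead s])).
  by move=> [x s] _ /=; congr pair; apply/val_inj.
by move=> s _; rewrite [RHS]tuple_eta; apply/val_inj.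
Qed.

Section Blowup.
Variable R : archiRealFieldType.
Implicit Types c : R.

Lemma exists_nat_ge c : exists n0 : nat, forall n : nat, (n0 <= n)%N -> c <= n%:R.
Proof.
exists (Num.bound c) => n le_n.
have [c0|/ltW c0] := lerP 0 c; last exact: le_trans c0 (ler0n _ _).
by apply/ltW/(lt_le_trans (archi_boundP c0)); rewrite ler_nat.
Qed.

(** Elements outside the set add at most [c / 2 * #|V| * #|S|] to the degree sum, and each element
    inside at most [#|V|]. *)
Lemma card_large_degree c (V S : finType) (r : V -> S -> bool) :
  (0 < #|V|)%N ->
  c * #|V|%:R * #|S|%:R <= (\sum_s #|[set x | r x s]|)%:R ->
  c / 2 * #|S|%:R <= #|[set s | c / 2 * #|V|%:R <= #|[set x | r x s]|%:R]|%:R.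
Proof.
move=> V0 h; set B := [set s | _].
have Vpos : 0 < #|V|%:R :> R by rewrite ltr0n.
have [c0|c0] := ltrP c 0.
  by apply: (@le_trans _ _ 0) => //; rewrite mulr_le0_ge0 // pmulr_lle0 ?invr_gt0 // ltW.
suff: (\sum_s #|[set x | r x s]|)%:R <=
    #|V|%:R * #|B|%:R + c / 2 * #|V|%:R * #|S|%:R.
  by move=> /(le_trans h) h2; rewrite -(ler_pM2l Vpos); nra.
rewrite natr_sum (bigID (mem B)) /= lerD //.
  rewrite -[#|B|]sum1_card natr_sum mulr_sumr ler_sum // => s _.
  by rewrite mulr1 ler_nat max_card.
rewrite -[#|S|]sum1_card natr_sum mulr_sumr big_mkcond ler_sum // => s _.
case: ifPn => [|_]; first by rewrite inE -ltNge mulr1 => /ltW.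
by rewrite mulr1 !mulr_ge0 ?invr_ge0.
Qed.

(** Elements of [S] of small degree are dropped first, which costs the factor [c / 2]; then the
    entries of [ys] are picked one by one, each keeping a proportion [c / 4] of the surviving
    elements. *)
Lemma common_neighbours c t : 0 < c -> exists2 c' : R, 0 < c' &
  exists n0, forall (V S : finType) (r : V -> S -> bool), (n0 <= #|V|)%N ->
    c * #|V|%:R * #|S|%:R <= (\sum_s #|[set x | r x s]|)%:R ->
    exists ys : seq V, [/\ uniq ys, size ys = t &
      c' * #|S|%:R <= #|[set s | all (r^~ s) ys]|%:R].
Proof.
move=> c0; exists (c / 2 * (c / 4) ^+ t); first by rewrite mulr_gt0 ?exprn_gt0 ?divr_gt0.
have [n0 hn0] := exists_nat_ge (4 * t%:R / c).
exists (maxn n0 t.+1) => V S r; rewrite geq_max => /andP[le_n lt_tV] hdeg.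
have V0 : (0 < #|V|)%N by apply: leq_trans lt_tV.
have Vpos : 0 < #|V|%:R :> R by rewrite ltr0n.
have hn : t%:R <= c / 4 * #|V|%:R.
  by have := hn0 _ le_n; rewrite ler_pdivrMr // => h; nra.
have hB := card_large_degree V0 hdeg.
set B := [set s | _] in hB.
suff: forall i, (i <= t)%N -> exists ys : seq V, [/\ uniq ys, size ys = i &
    (c / 4) ^+ i * #|B|%:R <= #|[set s in B | all (r^~ s) ys]|%:R].
  move=> /(_ t (leqnn _)) [ys [uys sys hys]]; exists ys; split => //.
  have : c / 2 * (c / 4) ^+ t * #|S|%:R <= (c / 4) ^+ t * #|B|%:R.
    by rewrite mulrAC [X in _ <= X]mulrC ler_wpM2r // exprn_ge0 // divr_ge0 // ltW.
  move=> /le_trans /(_ hys) /le_trans; apply; rewrite ler_nat subset_leq_card //.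
  by apply/subsetP => s; rewrite !inE => /andP[].
elim=> [_|i IHi lt_it].
  by exists [::]; split => //; rewrite expr0 mul1r ler_nat subset_leq_card //; apply/subsetP => s; rewrite !inE => ->.
have [ys [uys sys hys]] := IHi (ltnW lt_it).
set C := [set s in B | all (r^~ s) ys] in hys.
have [y yys hy] : exists2 y, y \notin ys & c / 4 * #|C|%:R <= #|[set s in C | r y s]|%:R.
  apply/exists_inP; apply: contraT; rewrite negb_exists_in => /forall_inP small.
  have [y0 y0ys] : exists y, y \notin ys.
    apply/existsP; rewrite -[X in is_true X]negbK negb_exists; apply/negP => /forallP full.
    have : (#|V| <= size ys)%N.
      by rewrite (leq_trans _ (card_size ys)) // subset_leq_card //; apply/subsetP => y _; have := full y; rewrite negbK.
    by rewrite sys leqNgt (leq_trans lt_it) // ltnW.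
  have C0 : 0 < #|C|%:R :> R.
    by have := small y0 y0ys; rewrite -ltNge => /(le_lt_trans (ler0n _ _)); rewrite pmulr_rgt0 // divr_gt0.
  (* If no new [y] works, new vertices account for at most half of this degree sum, and those of
     [ys], by the choice of [n0], for less than the other half. *)
  have h1 : c / 2 * #|V|%:R * #|C|%:R <= (\sum_(s in C) #|[set x | r x s]|)%:R.
    rewrite natr_sum -[#|C|]sum1_card natr_sum mulr_sumr ler_sum // => s.
    by rewrite !inE mulr1 => /andP[].
  move: h1; rewrite (sum_card_exchange (fun s x => r x s)) natr_sum (bigID (mem ys)) /=.
  rewrite -big_uniq //=.
  have h2 : \sum_(x <- ys) #|[set s in C | r x s]|%:R <= i%:R * #|C|%:R :> R.
    rewrite -sys -sum1_size natr_sum mulr_suml ler_sum // => x _.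
    by rewrite mul1r ler_nat subset_leq_card //; apply/subsetP => s; rewrite inE => /andP[].
  have h3 : \sum_(x | x \notin ys) #|[set s in C | r x s]|%:R <= c / 4 * #|V|%:R * #|C|%:R :> R.
    rewrite -[#|V|]sum1_card natr_sum mulr_sumr mulr_suml big_mkcond ler_sum // => x _.
    case: ifPn => [/small|_]; first by rewrite -ltNge mulr1 => /ltW.
    by rewrite !mulr_ge0 ?ler01 ?invr_ge0 ?ler0n // ltW.
  have hi : i%:R + 1 <= t%:R :> R by rewrite natr1 ler_nat.
  move=> h4; exfalso; nra.
exists (y :: ys); split => //=; first by rewrite yys.
  by rewrite sys.
rewrite exprS -mulrA; apply: le_trans (_ : c / 4 * #|C|%:R <= _); first by rewrite ler_wpM2l // divr_ge0 // ltW.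
apply: le_trans hy _; rewrite ler_nat subset_leq_card //.
by apply/subsetP => s; rewrite !inE -andbA => /and3P[-> -> ->].
Qed.

(** The first coordinate is peeled off: [t] values of it share a positive proportion of all tails.
    The lists for different coordinates may overlap here; in the applications [P] keeps them
    apart. *)
Lemma dense_tuples_blowup k c t : 0 < c ->
  exists n0, forall (V : finType) (P : pred (seq V)), (n0 <= #|V|)%N ->
    c * #|V|%:R ^+ k <= #|[set s : k.-tuple V | P s]|%:R ->
    exists A : seq (seq V), [/\ size A = k,
      all (fun l => uniq l && (size l == t)) A &
      forall s, all2 (fun x (l : seq V) => x \in l) s A -> P s].
Proof.
elim: k c => [|k IHk] c c0.
  exists 0%N => V P _; rewrite expr0 mulr1 => hc; exists [::]; split => // -[] // _.
  have : (0 < #|[set s : 0.-tuple V | P s]|)%N.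
    by rewrite -(ltr_nat R) (lt_le_trans c0).
  by case/card_gt0P => s; rewrite inE tuple0.
have [c' c'0 [n0 h0]] := common_neighbours t c0.
have [n1 h1] := IHk c' c'0.
exists (maxn n0 n1) => V P; rewrite geq_max => /andP[le0 le1].
rewrite card_tuple_cons => hP.
have := h0 V _ (fun x (s : k.-tuple V) => P (x :: s)) le0.
rewrite (sum_card_exchange (fun (s : k.-tuple V) x => P (x :: s)) predT) /=.
rewrite card_tuple natrX -mulrA -exprS => /(_ hP)[ys [uys sys hys]].
have [A [sA uA hA]] := h1 V (fun s => all (fun y => P (y :: s)) ys) le1 hys.
exists (ys :: A); split => /=; rewrite ?sA ?uys ?sys ?eqxx //.
case=> // x s /andP[xys /hA /allP]; exact.
Qed.

End Blowup.

(** * Squared paths and patterns *)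

Section SquaredPaths.
Variables (T : Type) (E : T -> T -> T -> bool).

Definition clique4 a b c d := [&& E a b c, E a b d, E a c d & E b c d].

(** Vacuously true on fewer than four entries, so three entries alone need not form an edge. *)
Fixpoint sqpath (s : seq T) : bool :=
  if s is a :: s1 then
    (if s1 is [:: b, c, d & _] then clique4 a b c d else true) && sqpath s1
  else true.

Lemma sqpath_catr s1 s2 : sqpath (s1 ++ s2) -> sqpath s2.
Proof. by elim: s1 => //= x s1 IHs /andP[_ /IHs]. Qed.

Lemma sqpath_catl s1 s2 : sqpath (s1 ++ s2) -> sqpath s1.
Proof.
elim: s1 => //= x s1 IHs /andP[hx /IHs ->]; rewrite andbT.
by move: hx; case: s1 {IHs} => [|y [|z [|t s1]]].
Qed.

(** The two parts overlap in three entries, so four consecutive entries always lie within one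
    part. *)
Lemma sqpath_glue s1 s2 a b c :
  sqpath (s1 ++ [:: a; b; c]) -> sqpath [:: a, b, c & s2] ->
  sqpath (s1 ++ [:: a, b, c & s2]).
Proof.
elim: s1 => // x s1 IHs /= /andP[hx /IHs IH] /IH ->; rewrite andbT.
by move: hx; case: s1 {IHs IH} => [|y [|z [|t s1]]].
Qed.

End SquaredPaths.

Lemma sqpath_map (S T : eqType) (E : S -> S -> S -> bool) (E' : T -> T -> T -> bool)
    (g : S -> T) s :
  {in s & &, forall x y z, E x y z -> E' (g x) (g y) (g z)} ->
  sqpath E s -> sqpath E' (map g s).
Proof.
elim: s => //= a s IHs hg /andP[ha hs].
have hg' x y z : x \in a :: s -> y \in a :: s -> z \in a :: s ->
  E x y z -> E' (g x) (g y) (g z) by move=> xs ys zs; exact: hg.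
rewrite IHs // ?andbT {hg}; last first.
  by move=> x y z xs ys zs /hg'; apply; rewrite inE ?xs ?ys ?zs orbT.
case: s ha hg' {IHs hs} => [|b [|c [|d s]]] //= /and4P[h1 h2 h3 h4] hg'.
by apply/and4P; split; apply: hg' => //; rewrite !inE eqxx ?orbT.
Qed.

Definition symmetric3 (T : Type) (E : T -> T -> T -> bool) :=
  (forall x y z, E x y z = E y x z) /\ (forall x y z, E x y z = E x z y).

(** * Pair neighbourhoods and greedy choices of vertices *)

Section Hypergraph.
Variables (V : finType) (H : hypergraph3 V).

Definition adj u v w := [set u; v; w] \in edges H.

Lemma adj_sym : symmetric3 adj.
Proof.
by split=> x y z; rewrite /adj; [rewrite [[set x; y]]setUC | rewrite setUAC].
Qed.

Lemma adj_neq u v w : adj u v w -> [/\ u != v, u != w & v != w].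
Proof.
move=> /edges_card3; rewrite -setUA cardsU1 cards2 !inE negb_or.
by case: (u == v); case: (u == w); case: (v == w).
Qed.

Definition nb (u v : V) : {set V} := [set x | adj u v x].

(** The map [x |-> {u, v, x}] is a bijection from [nb u v] to the edges through [u] and [v]. *)
Lemma card_nb u v : u != v -> #|nb u v| = pair_degree H u v.
Proof.
move=> uv; rewrite /pair_degree -(card_in_imset (f := fun x => [set u; v; x])).
  apply: eq_card => e; rewrite inE; apply/imsetP/idP => [[x]|].
    by rewrite inE => hx ->; rewrite [X in X && _]hx !inE !eqxx ?orbT.
  case/and3P => he ue ve; have e3 := edges_card3 he.
  have : #|e :\: [set u; v]| = 1%N.
    rewrite cardsD (setIidPr _) ?e3 ?cards2 ?uv //.
    by apply/subsetP => x; rewrite !inE => /orP[]/eqP->.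
  move/eqP/cards1P => [x ex]; have he' : e = [set u; v; x].
    apply/setP => y; have := congr1 (fun A : {set V} => y \in A) ex.
    rewrite !inE; case: eqP => [->|_] /=; first by rewrite ue.
    by case: eqP => [->|_] //=; rewrite ve.
  by exists x => //; rewrite inE /adj -he'.
move=> x y; rewrite !inE => /adj_neq[_ ux vx] _ /setP/(_ x).
by rewrite !inE eqxx orbT eq_sym (negPf ux) eq_sym (negPf vx) /= => /esym/eqP.
Qed.

Definition rich (R : numDomainType) (U : {set V}) (j : nat) (d : R) :=
  forall qs : seq (V * V), size qs = j -> all (fun q => q.1 != q.2) qs ->
    d <= #|[set x in U | all (fun q => adj q.1 q.2 x) qs]|%:R.

(** [env] lists the vertices chosen so far and [ps] refers to positions in it; under [wf_conds] the
    default of [nth] is never reached. *)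
Fixpoint admissible (steps : seq ({set V} * seq (nat * nat))) (env s : seq V) : bool :=
  match steps, s with
  | [::], [::] => true
  | (U, ps) :: st, x :: s' =>
    [&& x \in U, x \notin env,
      all (fun p => adj (nth x env p.1) (nth x env p.2) x) ps
      & admissible st (rcons env x) s']
  | _, _ => false
  end.

Fixpoint wf_conds (m : nat) (cs : seq (seq (nat * nat))) : bool :=
  if cs is ps :: cs' then
    all (fun p => [&& p.1 < m, p.2 < m & p.1 != p.2]%N) ps && wf_conds m.+1 cs'
  else true.

(** Discounting the at most [size env + size steps] vertices already used leaves at least [d] new
    candidates at each step. *)
Lemma admissible_count (R : numDomainType) (d : R) (steps : seq ({set V} * seq (nat * nat)))
    (env : seq V) :
  0 <= d -> uniq env -> wf_conds (size env) (map snd steps) ->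
  (forall U ps, (U, ps) \in steps ->
     rich U (size ps) (d + (size env + size steps)%:R)) ->
  d ^+ size steps <= #|[set s : (size steps).-tuple V | admissible steps env s]|%:R.
Proof.
move=> d0; elim: steps env => [|[U ps] st IHst] env ue /=.
  move=> _ _; rewrite expr0 ler1n card_gt0; apply/set0Pn; exists [tuple].
  by rewrite inE.
case/andP => wps wst hrich.
rewrite exprS [X in _ <= X%:R](card_tuple_cons _ (admissible ((U, ps) :: st) env)).
pose G := [set x in U | all (fun q => adj q.1 q.2 x) (map (fun p => (nth x env p.1, nth x env p.2)) ps)].
pose G' := [set x in U | (x \notin env) && all (fun p => adj (nth x env p.1) (nth x env p.2) x) ps].
have hG : d <= #|G'|%:R.
  (* With an empty [env] there is no default vertex for [nth], but then [ps] is empty as well. *)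
  case: env ue wps wst hrich @G @G' => [|x0 env] ue wps wst hrich G G'.
    have ps0 : ps = [::] by case: ps wps {hrich wst G G'} => // p ps /=; rewrite ltn0.
    rewrite ps0 in hrich G G' *.
    have h := hrich U [::] (mem_head _ _) [::] erefl isT.
    have eG : [set x in U | all (fun q => adj q.1 q.2 x) [::]] = G' by apply/setP => x; rewrite !inE.
    by move: h; rewrite eG; apply: le_trans; rewrite lerDl.
  set e := x0 :: env in ue wps wst hrich G G' *.
  have := hrich U ps (mem_head _ _) (map (fun p => (nth x0 e p.1, nth x0 e p.2)) ps).
  rewrite size_map all_map => /(_ erefl).
  have -> : all (preim (fun p => (nth x0 e p.1, nth x0 e p.2)) (fun q => q.1 != q.2)) ps.
    apply: sub_all wps => p /and3P[p1 p2 p12] /=.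
    by rewrite nth_uniq.
  move=> /(_ isT); set G0 := [set x in U | _] => hG0.
  have sub : G0 \subset G' :|: [set x in e].
    apply/subsetP => x; rewrite [x \in G0]inE !inE -!/e => /andP[-> /=].
    rewrite all_map => h.
    have -> : all (fun p => adj (nth x e p.1) (nth x e p.2) x) ps.
      apply/allP => p pin; have /allP/(_ _ pin)/= := h; have /allP/(_ _ pin)/and3P[p1 p2 _] := wps.
      by rewrite (set_nth_default x) // (set_nth_default x _ p2).
    by rewrite andbT orNb.
  have c1 : (#|[set x in e]| <= size e)%N by rewrite cardsE card_size.
  have c2 : (#|G0| <= #|G'| + #|[set x in e]|)%N.
    exact: leq_trans (subset_leq_card sub) (leq_card_setU _ _).
  have c3 : (#|G0| <= #|G'| + size e)%N by apply: leq_trans c2 _; rewrite leq_add2l.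
  have c4 : #|G0|%:R <= #|G'|%:R + (size e)%:R :> R by rewrite -natrD ler_nat.
  have := le_trans hG0 c4; rewrite natrD addrCA [#|G'|%:R + _]addrC lerD2l.
  by apply: le_trans; rewrite lerDl.
rewrite natr_sum; apply: le_trans (_ : \sum_(x in G') d ^+ size st <= _).
  rewrite sumr_const -mulr_natl ler_wpM2r ?exprn_ge0 //.
rewrite big_mkcond; apply: ler_sum => x _; case: ifPn => // xG'.
have hx : (x \in U) && (x \notin env) && all (fun p => adj (nth x env p.1) (nth x env p.2) x) ps.
  by move: xG'; rewrite inE andbA.
have [/andP[xU xenv] xps] := andP hx.
apply: le_trans (IHst (rcons env x) _ _ _) _.
- by rewrite rcons_uniq xenv.
- by rewrite size_rcons.
- move=> U' ps' hin; rewrite size_rcons addSnnS; apply: hrich.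
  by rewrite inE hin orbT.
rewrite ler_nat subset_leq_card //; apply/subsetP => s; rewrite !inE => hs.
by rewrite /= xU xenv xps.
Qed.

End Hypergraph.

Section Admissible.
Variables (V : finType) (H : hypergraph3 V).
Implicit Types (steps : seq ({set V} * seq (nat * nat))) (env s : seq V).

Lemma admissible_uniq steps env s :
  uniq env -> admissible H steps env s -> uniq (env ++ s).
Proof.
elim: steps env s => [|[U ps] st IHst] env [|x s] //=; first by rewrite cats0.
by move=> ue /and4P[_ xe _]; rewrite -cat_rcons; apply: IHst; rewrite rcons_uniq xe.
Qed.

Lemma admissible_mem x0 steps env s i :
  admissible H steps env s -> (i < size steps)%N ->
  nth x0 s i \in nth set0 (map fst steps) i.
Proof.
elim: steps env s i => [|[U ps] st IHst] env [|x s] [|i] //= /and4P[xU _ _ hs] //.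
exact: IHst hs.
Qed.

Lemma admissible_adj x0 steps env s i p :
  wf_conds (size env) (map snd steps) -> admissible H steps env s ->
  p \in nth [::] (map snd steps) i ->
  adj H (nth x0 (env ++ s) p.1) (nth x0 (env ++ s) p.2)
    (nth x0 (env ++ s) (size env + i)).
Proof.
elim: steps env s i => [|[U ps] st IHst] env [|x s] [|i] //=.
  move=> /andP[wps _] /and4P[_ _ /allP hps _] pin.
  have /allP/(_ _ pin)/and3P[p1 p2 _] := wps; have := hps _ pin.
  by rewrite addn0 !nth_cat p1 p2 ltnn subnn /= (set_nth_default x0) // (set_nth_default x0 _ p2).
move=> /andP[_ wst] /and4P[_ _ _ hs] pin; rewrite -cat_rcons -addSnnS.
by rewrite -(size_rcons env x); apply: IHst => //; rewrite size_rcons.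
Qed.

End Admissible.

(* Vertices of a pattern are numbered "letters".  [F] lists the triples among the first
   [m] letters that are known to be edges; the [i]-th entry of [cs] lists the pairs of
   earlier letters that form an edge with the letter [m + i]. *)
Definition pattern0 (m : nat) (F : seq (nat * nat * nat)) (cs : seq (seq (nat * nat)))
  (i j l : nat) : bool :=
  ((i, j, l) \in F) || ((m <= l)%N && ((i, j) \in nth [::] cs (l - m))).

Definition pattern m F cs i j l :=
  [|| pattern0 m F cs i j l, pattern0 m F cs i l j, pattern0 m F cs j i l,
      pattern0 m F cs j l i, pattern0 m F cs l i j | pattern0 m F cs l j i].

(** Copies of one letter never lie in a common edge, so any four consecutive entries of a squared
    path of words carry distinct letters. *)
Definition word_edge m F cs (p q r : nat * nat) :=
  uniq [:: p.1; q.1; r.1] && pattern m F cs p.1 q.1 r.1.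

(* A pair [(l, c)] stands for the [c]-th copy of the letter [l] in the blow-up; the
   first [m] letters have the single copy [0]. *)
Definition letter_ok (m k t : nat) (p : nat * nat) :=
  ((p.1 < m) && (p.2 == 0))%N || [&& m <= p.1, p.1 < m + k & p.2 < t]%N.

(** * Realising the words of a pattern in a blow-up *)

Section Lift.
Variables (V : finType) (H : hypergraph3 V) (x0 : V) (t : nat).
Variables (steps : seq ({set V} * seq (nat * nat))) (env : seq V) (A : seq (seq V)).
Hypothesis t_gt0 : (0 < t)%N.
Hypothesis sizeA : size A = size steps.
Hypothesis uniqA : all (fun l => uniq l && (size l == t)) A.
Hypothesis admA : forall s, all2 (fun x (l : seq V) => x \in l) s A -> admissible H steps env s.

Let m := size env.
Let k := size steps.
Let cs := map snd steps.

Definition lift_letter (p : nat * nat) : V :=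
  if (p.1 < m)%N then nth x0 env p.1 else nth x0 (nth [::] A (p.1 - m)) p.2.

Let select (f : nat -> nat) := mkseq (fun i => nth x0 (nth [::] A i) (f i)) k.

Lemma size_copies i : (i < k)%N -> size (nth [::] A i) = t.
Proof. by rewrite /k -sizeA => ik; have /allP/(_ _ (mem_nth [::] ik))/andP[_ /eqP] := uniqA. Qed.

Lemma select_mem f : (forall i, f i < t)%N ->
  all2 (fun x (l : seq V) => x \in l) (select f) A.
Proof.
move=> hf; rewrite all2E size_mkseq sizeA eqxx /=.
apply/(all_nthP (x0, [::])) => i; rewrite size_zip size_mkseq sizeA minnn => ik.
by rewrite nth_zip ?size_mkseq ?sizeA //= nth_mkseq // mem_nth // size_copies.
Qed.

Lemma lift_letterE f p : letter_ok m k t p ->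
  (m <= p.1 -> p.2 = f (p.1 - m))%N -> lift_letter p = nth x0 (env ++ select f) p.1.
Proof.
rewrite /letter_ok /lift_letter nth_cat -/m; case: ltnP => // mp /= /andP[pk _] -> //.
by rewrite nth_mkseq // -(ltn_add2l m) subnKC.
Qed.

Lemma lift_letter_adj F p q r : wf_conds m cs ->
  all (fun e => adj H (nth x0 env e.1.1) (nth x0 env e.1.2) (nth x0 env e.2)) F ->
  all (fun e => [&& e.1.1 < m, e.1.2 < m & e.2 < m])%N F ->
  letter_ok m k t p -> letter_ok m k t q -> letter_ok m k t r ->
  word_edge m F cs p q r -> adj H (lift_letter p) (lift_letter q) (lift_letter r).
Proof.
move=> wf hF mF okp okq okr /andP[/=]; rewrite !inE negb_or !andbT => /andP[/andP[pq pr] qr] hpat.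
(* Letters that do not occur get copy [0], which exists because [0 < t]. *)
pose f i := if p.1 == (m + i)%N then p.2 else if q.1 == (m + i)%N then q.2
  else if r.1 == (m + i)%N then r.2 else 0%N.
have ft i : (f i < t)%N.
  rewrite /f; case: eqP => [e|_]; first by move: okp; rewrite /letter_ok e ltnNge leq_addr /= => /andP[].
  case: eqP => [e|_]; first by move: okq; rewrite /letter_ok e ltnNge leq_addr /= => /andP[].
  by case: eqP => [e|_] //; move: okr; rewrite /letter_ok e ltnNge leq_addr /= => /andP[].
have -> : lift_letter p = nth x0 (env ++ select f) p.1.
  by apply: lift_letterE => // mp; rewrite /f subnKC // eqxx.
have -> : lift_letter q = nth x0 (env ++ select f) q.1.
  by apply: lift_letterE => // mp; rewrite /f subnKC // eqxx (negPf pq).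
have -> : lift_letter r = nth x0 (env ++ select f) r.1.
  by apply: lift_letterE => // mp; rewrite /f subnKC // eqxx (negPf pr) (negPf qr).
have hs := admA (select_mem ft).
have [s12 s23] := adj_sym H.
have key i j l : pattern0 m F cs i j l -> adj H (nth x0 (env ++ select f) i)
    (nth x0 (env ++ select f) j) (nth x0 (env ++ select f) l).
  case/orP => [hin|/andP[ml hin]].
    have /allP/(_ _ hin)/= := hF; have /allP/(_ _ hin)/and3P[/= h1 h2 h3] := mF.
    by rewrite !nth_cat -/m h1 h2 h3.
  by have := admissible_adj x0 wf hs hin; rewrite -/m subnKC.
case/or4P: hpat => [/key //|/key|/key|/or3P[]/key]=> h.
- by rewrite s23.
- by rewrite s12.
- by rewrite s12 s23.
- by rewrite s23 s12.
- by rewrite s12 s23 s12.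
Qed.

(** Copies of one letter differ because each list in [A] is duplicate-free; copies of different
    letters occur in a common admissible sequence, which has no repetition. *)
Lemma lift_letter_inj : uniq env ->
  {in letter_ok m k t &, injective lift_letter}.
Proof.
move=> ue p q; rewrite !unfold_in => okp okq.
have [e|pq] := eqVneq p.1 q.1.
  case: p q e okp okq => [i a] [j b] /= <-; rewrite /letter_ok /lift_letter /=.
  case: ltnP => [im|mi] /=; first by rewrite !orbF => /eqP-> /eqP->.
  move=> /andP[ik ta] /andP[_ tb].
  have ik' : (i - m < k)%N by rewrite -(ltn_add2l m) subnKC.
  move/eqP; rewrite nth_uniq ?size_copies // => [/eqP-> //|].
  by have /allP/(_ (nth [::] A (i - m)))/(_ _)/andP[] := uniqA; rewrite ?mem_nth // sizeA.
pose f i := if p.1 == (m + i)%N then p.2 else if q.1 == (m + i)%N then q.2 else 0%N.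
have ft i : (f i < t)%N.
  rewrite /f; case: eqP => [e|_]; first by move: okp; rewrite /letter_ok e ltnNge leq_addr /= => /andP[].
  by case: eqP => [e|_] //; move: okq; rewrite /letter_ok e ltnNge leq_addr /= => /andP[].
rewrite (@lift_letterE f p) // ?(@lift_letterE f q) //; first last.
- by move=> mp; rewrite /f subnKC // eqxx.
- by move=> mp; rewrite /f subnKC // (negPf pq) eqxx.
have hs := admA (select_mem ft); have us := admissible_uniq ue hs.
have lt_size r : letter_ok m k t r -> (r.1 < size (env ++ select f))%N.
  rewrite size_cat size_mkseq -/m /letter_ok => /orP[/andP[h _]|/and3P[]] //.
  by rewrite (leq_trans h) // leq_addr.
by move/eqP; rewrite nth_uniq ?lt_size // (negPf pq).
Qed.

Lemma lift_letter_mem p : (m <= p.1)%N -> (p.1 < m + k)%N -> (p.2 < t)%N ->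
  lift_letter p \in nth set0 (map fst steps) (p.1 - m).
Proof.
move=> mp pk pt; have pk' : (p.1 - m < k)%N by rewrite -(ltn_add2l m) subnKC.
have hs := admA (select_mem (fun _ => pt) : all2 _ (select (fun _ => p.2)) A).
have := admissible_mem x0 hs pk'.
by rewrite nth_mkseq // /lift_letter ltnNge mp.
Qed.

Lemma lift_letter_sqpath F w : wf_conds m cs ->
  all (fun e => adj H (nth x0 env e.1.1) (nth x0 env e.1.2) (nth x0 env e.2)) F ->
  all (fun e => [&& e.1.1 < m, e.1.2 < m & e.2 < m])%N F ->
  all (letter_ok m k t) w ->
  sqpath (word_edge m F cs) w -> sqpath (adj H) (map lift_letter w).
Proof.
move=> wf hF mF /allP okw; apply: sqpath_map => p q r pw qw rw.
by apply: lift_letter_adj => //; apply: okw.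
Qed.

End Lift.

(** * Connecting *)

Section Dense.
Variable R : realType.
Implicit Types (eta mu : R) (V : finType).

(** The pairs range over all of [V], whereas neighbours are counted in [U] and relative to its
    size. *)
Definition dense V (H : hypergraph3 V) (U : {set V}) eta :=
  forall u v, u != v -> (4 / 5 + eta) * #|U|%:R <= #|U :&: nb H u v|%:R.

(** Each pair condition excludes at most a fraction [1 / 5 - eta] of [U]. *)
Lemma dense_rich V (H : hypergraph3 V) U eta j : dense H U eta ->
  rich H U j ((1 - j%:R * (1 / 5 - eta)) * #|U|%:R).
Proof.
move=> dU; elim: j => [|j IHj] [|q qs] //=.
  move=> _ _; rewrite mul0r subr0 mul1r ler_nat; apply: subset_leq_card.
  by apply/subsetP => x; rewrite inE => ->.
case=> sqs /andP[q12 dqs]; have h1 := IHj _ sqs dqs; have h2 := dU _ _ q12.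
set B := [set x in U | _] in h1; set C := U :&: _ in h2; set D := [set x in U | _].
have -> : D = B :&: C.
  by apply/setP => x; rewrite !inE; do !case: (_ \in _); rewrite ?andbF //= andbC.
have h3 : #|B|%:R + #|C|%:R <= #|U|%:R + #|B :&: C|%:R :> R.
  rewrite -!natrD ler_nat -cardsUI addnC [X in (_ <= X)%N]addnC leq_add2l subset_leq_card //.
  by apply/subsetP => x; rewrite !inE; case: (x \in U).
rewrite -natr1; nra.
Qed.

Definition uniform_steps V (U : {set V}) (cs : seq (seq (nat * nat))) := [seq (U, ps) | ps <- cs].

(** Five conditions leave a fraction [5 * eta] of [U]; one [eta] of it is counted, and the rest
    easily covers the at most [m + k] used vertices. *)
Lemma admissible_dense eta mu (k m : nat) : 0 < eta -> eta <= 1 / 5 -> 0 < mu ->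
  exists n0, forall V (H : hypergraph3 V) (U : {set V}) (cs : seq (seq (nat * nat))) (env : seq V),
    (n0 <= #|V|)%N -> mu * #|V|%:R <= #|U|%:R -> dense H U eta ->
    size cs = k -> size env = m -> all (fun ps => size ps <= 5)%N cs ->
    wf_conds m cs -> uniq env ->
    (eta * mu) ^+ k * #|V|%:R ^+ k <=
      #|[set s : k.-tuple V | admissible H (uniform_steps U cs) env s]|%:R.
Proof.
move=> e0 e5 m0; have em0 : 0 < eta * mu by rewrite mulr_gt0.
have [n0 hn0] := exists_nat_ge ((m + k)%:R / (eta * mu)).
exists n0 => V H U cs env le_n hU dU scs senv cs5 wf ue.
have ss : size (uniform_steps U cs) = k by rewrite size_map.
rewrite -exprMn -ss; apply: admissible_count => //.
- by rewrite mulr_ge0 ?ler0n // ltW.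
- by rewrite senv -map_comp map_id_in.
move=> U' ps; rewrite ss senv => /mapP[ps' ps'cs [-> ->]] qs sqs dqs.
apply: le_trans (dense_rich dU sqs dqs).
have j5 : (size ps')%:R <= 5 :> R by rewrite ler_nat; have /allP/(_ _ ps'cs) := cs5.
have h0 := hn0 _ le_n; rewrite ler_pdivrMr // in h0.
have U0 : 0 <= #|U|%:R :> R by rewrite ler0n.
have h2 : 5 * eta * #|U|%:R <= (1 - (size ps')%:R * (1 / 5 - eta)) * #|U|%:R.
  by rewrite ler_wpM2r //; nra.
apply: le_trans h2; have n0' : 0 <= #|V|%:R :> R by rewrite ler0n.
have : eta * (mu * #|V|%:R) <= eta * #|U|%:R by rewrite ler_pM2l.
by move=> h3; nra.
Qed.

(* Letters: 0..2 = a b c, 3..5 = x y z, 6..8 = d e f, 9..11 = z' y' x', 12 = w and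
   13..16 = u1..u4.  The walk is
     a b c  d e f u1 d e w u2 d y' w u3 x' y' w u4 x' y' z'  x y z:
   it moves from d e f to x' y' z' by changing one coordinate at a time through w,
   the change being made possible by a common extension u_i of two cliques.  Each
   letter lies on at most five pairs of earlier letters, and 5/5 = 1 is exactly what
   the degree condition allows. *)
Let connect_fixed := [:: (0, 1, 2); (3, 4, 5)]%N.

Let connect_conds : seq (seq (nat * nat)) := [::
  [:: (0, 1); (0, 2); (1, 2)];
  [:: (1, 2); (1, 6); (2, 6)];
  [:: (2, 6); (2, 7); (6, 7)];
  [:: (3, 4); (3, 5); (4, 5)];
  [:: (3, 4); (3, 9); (4, 9)];
  [:: (3, 9); (3, 10); (9, 10)];
  [:: (6, 7); (6, 10); (10, 11)];
  [:: (6, 7); (6, 8); (7, 8); (6, 12); (7, 12)];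
  [:: (6, 7); (6, 12); (7, 12); (6, 10); (10, 12)];
  [:: (6, 10); (6, 12); (10, 12); (10, 11); (11, 12)];
  [:: (10, 11); (10, 12); (11, 12); (9, 10); (9, 11)]]%N.

Let connect_inner : seq (nat * nat) := [:: (6, 0); (7, 0); (8, 0); (13, 0);
  (6, 1); (7, 1); (12, 0); (14, 0); (6, 2); (10, 0); (12, 1); (15, 0); (11, 0);
  (10, 1); (12, 2); (16, 0); (11, 1); (10, 2); (9, 0)]%N.

(** Eleven letters are chosen after the six fixed ones, and the blow-up turns the walk into a path
    with distinct vertices; that the walk is a squared path of the pattern is a computation. *)
Lemma connecting eta mu : 0 < eta -> eta <= 1 / 5 -> 0 < mu ->
  exists n0, forall V (H : hypergraph3 V) (U : {set V}),
    (n0 <= #|V|)%N -> mu * #|V|%:R <= #|U|%:R -> dense H U eta ->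
    forall a b c x y z, uniq [:: a; b; c; x; y; z] -> adj H a b c -> adj H x y z ->
    exists p, [/\ size p = 19, uniq p, {subset p <= U} &
      sqpath (adj H) ([:: a, b, c & p] ++ [:: x; y; z])].
Proof.
move=> e0 e5 m0; have [n0 h0] := admissible_dense 11 6 e0 e5 m0.
have em0 : 0 < (eta * mu) ^+ 11 by rewrite exprn_gt0 // mulr_gt0.
(* No letter occurs more than three times in the walk, hence three copies. *)
have [n1 h1] := dense_tuples_blowup 11 3 em0.
exists (maxn n0 n1) => V H U; rewrite geq_max => /andP[le0 le1] hU dU a b c x y z ue abc xyz.
have cnt := h0 V H U connect_conds [:: a; b; c; x; y; z] le0 hU dU erefl erefl isT isT ue.
have [A [sA uA hA]] := h1 V _ le1 cnt.
set st := uniform_steps _ _ in hA; set env := [:: a; b; c; x; y; z] in ue hA.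
have cs : map snd st = connect_conds by rewrite -map_comp map_id_in.
pose g := lift_letter a env A.
exists (map g connect_inner); split.
- by rewrite size_map.
- rewrite map_inj_in_uniq // => p q pin qin.
  apply: (@lift_letter_inj V H a 3 st env A) => //; rewrite unfold_in.
  + by apply/allP: p pin.
  + by apply/allP: q qin.
- move=> v /mapP[p pin ->].
  have := @lift_letter_mem V H a 3 st env A sA uA hA p.
  have okp : [&& 6 <= p.1, p.1 < 17 & p.2 < 3]%N by apply/allP: p pin.
  have [h1' h2' h3'] := and3P okp; move=> /(_ h1' h2' h3').
  have fs : map fst st = nseq 11 U by rewrite -map_comp.
  rewrite fs nth_nseq; have : (p.1 - 6 < 11)%N by rewrite ltn_subLR.
  by move=> ->.
have := @lift_letter_sqpath V H a 3 st env A isT sA uA hA connect_fixed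
  ([:: (0, 0); (1, 0); (2, 0)] ++ connect_inner ++ [:: (3, 0); (4, 0); (5, 0)])%N.
rewrite cs => /(_ isT); rewrite /= !andbT; apply => //.
by rewrite abc xyz.
Qed.

End Dense.

(** * Absorbing *)

Section Absorbers.
Variable R : realType.
Implicit Types (eta mu : R) (V : finType).

(** The insertion is in the middle, so both end triples of a 6-tuple stay in place. *)
Definition absorbs V (H : hypergraph3 V) (s : seq V) (v : V) : bool :=
  sqpath (adj H) (take 3 s ++ v :: drop 3 s).

Definition absorber V (H : hypergraph3 V) (U : {set V}) (s : seq V) (v : V) : bool :=
  [&& all (mem U) s, uniq s, sqpath (adj H) s & absorbs H s v].

(* Letter 0 is the vertex to be absorbed, letters 1..6 form the absorber. *)
Let absorber_conds : seq (seq (nat * nat)) := [::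
  [::];
  [:: (0, 1)];
  [:: (0, 1); (0, 2); (1, 2)];
  [:: (0, 2); (0, 3); (1, 2); (1, 3); (2, 3)];
  [:: (0, 3); (0, 4); (2, 3); (2, 4); (3, 4)];
  [:: (0, 4); (0, 5); (3, 4); (3, 5); (4, 5)]]%N.

Lemma absorber_count eta mu : 0 < eta -> eta <= 1 / 5 -> 0 < mu ->
  exists n0, forall V (H : hypergraph3 V) (U : {set V}),
    (n0 <= #|V|)%N -> mu * #|V|%:R <= #|U|%:R -> dense H U eta ->
    forall v, (eta * mu) ^+ 6 * #|V|%:R ^+ 6 <=
      #|[set s : 6.-tuple V | absorber H U s v]|%:R.
Proof.
move=> e0 e5 m0; have [n0 h0] := admissible_dense 6 1 e0 e5 m0.
exists n0 => V H U le0 hU dU v.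
have := h0 V H U absorber_conds [:: v] le0 hU dU erefl erefl isT isT isT.
move/le_trans; apply; rewrite ler_nat; apply: subset_leq_card.
apply/subsetP => s; rewrite !inE; set st := uniform_steps _ _ => adm.
have cs : map snd st = absorber_conds by rewrite -map_comp map_id_in.
(* A single tuple is a blow-up with one copy of each letter, so lifting applies to it. *)
pose A := [seq [:: x] | x <- s].
have sA : size A = size st by rewrite size_map size_tuple.
have uA : all (fun l : seq V => uniq l && (size l == 1)%N) A.
  by apply/allP => l /mapP[x _ ->].
have hA s' : all2 (fun x (l : seq V) => x \in l) s' A -> admissible H st [:: v] s'.
  suff -> : all2 (fun x (l : seq V) => x \in l) s' A = (s' == s) by move=> /eqP->.
  rewrite /A; elim: (tval s) s' {adm A sA uA} => [|x s1 IHs] [|y s'] //=.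
  by rewrite IHs inE eqseq_cons.
have := admissible_uniq (isT : uniq [:: v]) adm => /= /andP[vs us].
have sU : all (mem U) s.
  apply/(all_nthP v) => i; rewrite size_tuple => i6 /=.
  have := admissible_mem v adm (i := i); rewrite size_map => /(_ i6).
  have -> : map fst st = nseq 6 U by rewrite -map_comp.
  by rewrite nth_nseq i6.
rewrite /absorber sU us /=.
have hl w := @lift_letter_sqpath V H v 1 st [:: v] A isT sA uA hA [::] w.
rewrite cs in hl.
case/tupleP: s @A {hA adm vs us sU} sA uA hl => a s; case/tupleP: s => b s; case/tupleP: s => c s.
case/tupleP: s => d s; case/tupleP: s => e s; case/tupleP: s => f s; rewrite tuple0 => A sA uA hl.
have h1 := hl [:: (1, 0); (2, 0); (3, 0); (4, 0); (5, 0); (6, 0)]%N isT isT isT isT isT.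
have h2 := hl [:: (1, 0); (2, 0); (3, 0); (0, 0); (4, 0); (5, 0); (6, 0)]%N isT isT isT isT isT.
by apply/andP; split.
Qed.

(** Averaging over all 6-tuples: each vertex is absorbed by a proportion [(eta * mu) ^+ 6] of
    them. *)
Lemma absorber_weight eta mu : 0 < eta -> eta <= 1 / 5 -> 0 < mu ->
  exists n0, forall V (H : hypergraph3 V) (U : {set V}),
    (n0 <= #|V|)%N -> mu * #|V|%:R <= #|U|%:R -> dense H U eta ->
    forall w : V -> R, (forall v, 0 <= w v) -> 0 < \sum_v w v ->
    exists s, [/\ size s = 6, uniq s, {subset s <= U}, sqpath (adj H) s &
      (eta * mu) ^+ 6 * \sum_v w v <= \sum_(v | absorbs H s v) w v].
Proof.
move=> e0 e5 m0; have [n0 h0] := absorber_count e0 e5 m0.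
exists n0 => V H U le0 hU dU w w0 wpos.
have hcnt := h0 V H U le0 hU dU.
set c := (eta * mu) ^+ 6 in hcnt *.
have c0 : 0 < c by rewrite exprn_gt0 // mulr_gt0.
have [s hs] : exists s : 6.-tuple V, c * \sum_v w v <= \sum_(v | absorber H U s v) w v.
  apply/existsP; apply: contraT; rewrite negb_exists => /forallP small.
  have V0 : (0 < #|V|)%N.
    case: (posnP #|V|) wpos => // V0; rewrite big1 ?ltxx // => v.
    by have := fintype0 v.
  have : \sum_(s : 6.-tuple V) \sum_(v | absorber H U s v) w v <
      \sum_(s : 6.-tuple V) c * \sum_v w v.
    have [v _] := card_gt0P V0.
    apply: ltr_sum; first by apply/hasP; exists [tuple of nseq 6 v]; rewrite ?mem_index_enum.
    by move=> s _; rewrite ltNge.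
  rewrite sumr_const -mulr_natr card_tuple natrX (exchange_big_dep xpredT) //= ltNge => /negP[].
  rewrite mulrAC mulr_sumr ler_sum // => v _.
  rewrite sumr_const -[X in _ <= X]mulr_natl ler_wpM2r //.
  by apply: le_trans (hcnt v) _; rewrite ler_nat; apply: eq_leq; apply: eq_card => s; rewrite inE.
(* The absorbed weight is positive, so the tuple absorbs some vertex and is therefore itself a
   squared path in [U]. *)
have [v vs] : exists v, absorber H U s v.
  apply/existsP; apply: contraT; rewrite negb_exists => /forallP none.
  by move: hs; rewrite [X in _ <= X]big1 ?leNgt ?mulr_gt0 // => v hv; have := none v; rewrite hv.
have /and4P[/allP sU us ps _] := vs.
exists s; split=> //; first by rewrite size_tuple.
apply: le_trans hs _; rewrite big_mkcond [X in _ <= X]big_mkcond ler_sum // => u _.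
by case: ifP => [/and4P[_ _ _ ->]|_] //; case: ifP.
Qed.

End Absorbers.

Definition last3 (T : Type) (s : seq T) := drop (size s - 3) s.

Lemma cat_last3 (T : Type) (s1 s2 : seq T) :
  (3 <= size s2)%N -> last3 (s1 ++ s2) = last3 s2.
Proof.
move=> h; rewrite /last3 size_cat drop_cat -addnBA // ltnNge leq_addr /=.
by rewrite addKn.
Qed.

Lemma last3_split (T : Type) (s : seq T) : (3 <= size s)%N ->
  exists s0 x y z, s = s0 ++ [:: x; y; z] /\ last3 s = [:: x; y; z].
Proof.
move=> h; have : size (last3 s) = 3 by rewrite size_drop subKn.
case e : (last3 s) => [|x [|y [|z [|? ?]]]] // _.
by exists (take (size s - 3) s), x, y, z; split; rewrite // -e cat_take_drop.
Qed.

Lemma take3_split (T : Type) (s : seq T) : (3 <= size s)%N ->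
  exists a b c s0, s = [:: a, b, c & s0] /\ take 3 s = [:: a; b; c].
Proof. by case: s => [|a [|b [|c s]]] // _; exists a, b, c, s; rewrite /= take0. Qed.

(** * Paths that can absorb vertices without changing their ends *)

Section Flexible.
Variables (V : finType) (H : hypergraph3 V).
Implicit Types (P Q p s : seq V) (gs : seq (seq V)) (o : seq (option V)).

Lemma sqpath_join Q p P : (3 <= size Q)%N -> (3 <= size P)%N ->
  sqpath (adj H) Q -> sqpath (adj H) P ->
  sqpath (adj H) (last3 Q ++ p ++ take 3 P) -> sqpath (adj H) (Q ++ p ++ P).
Proof.
move=> /last3_split[s0 [x [y [z [-> ->]]]]] /take3_split[a [b [c [s1 [-> ->]]]]].
move=> hQ hP hp; rewrite -catA; apply: sqpath_glue => //.
exact: (@sqpath_glue _ _ ([:: x, y, z & p])).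
Qed.

(** Entry [i] of [o] is the vertex, if any, to be inserted into member [i] of [gs]. *)
Definition fits o gs := all2 (fun x g => if x is Some v then absorbs H g v else true) o gs.

(* The members of [gs] sit disjointly inside [P]; this is only recorded through its
   consequence, that vertices assigned to distinct members can be inserted into [P]
   without affecting the two ends along which [P] gets connected to other paths. *)
Definition flexible P gs := forall o, fits o gs ->
  exists s, [/\ perm_eq s (P ++ pmap id o), sqpath (adj H) s,
    take 3 s = take 3 P & last3 s = last3 P].

Lemma perm_size3 s P X : (3 <= size P)%N -> perm_eq s (P ++ X) -> (3 <= size s)%N.
Proof. by move=> hP /perm_size->; rewrite size_cat (leq_trans hP) ?leq_addr. Qed.

(** Insertions into [P] keep its first three vertices, so the connection through [p] survives
    them. *)
Lemma flexible_cat Q p P gs : (3 <= size Q)%N -> (3 <= size P)%N ->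
  sqpath (adj H) Q -> sqpath (adj H) (last3 Q ++ p ++ take 3 P) ->
  flexible P gs -> flexible (Q ++ p ++ P) gs.
Proof.
move=> hQ hP sQ sp fP o /fP[s [ps ss s3 l3]].
have hs := perm_size3 hP ps.
exists (Q ++ p ++ s); split.
- by rewrite -!catA !perm_cat2l.
- by apply: sqpath_join; rewrite ?s3.
- by rewrite !takel_cat.
- by rewrite !catA !cat_last3.
Qed.

Lemma flexible_absorber Q : size Q = 6 -> sqpath (adj H) Q -> flexible Q [:: Q].
Proof.
move=> Q6 sQ o; rewrite /fits; case: o => [|x [|? ?]] //=; rewrite ?andbF // andbT.
case: x => [v|] hv; last first.
  by exists Q; split; rewrite ?cats0.
exists (take 3 Q ++ v :: drop 3 Q); split => //.
- by rewrite perm_sym -[in X in perm_eq X _](cat_take_drop 3 Q) -catA perm_cat2l cats1 perm_rcons.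
- by rewrite take_size_cat // size_takel ?Q6.
- rewrite -cat_rcons cat_last3 ?size_drop ?Q6 //.
  by rewrite -[in RHS](cat_take_drop 3 Q) cat_last3 // size_drop Q6.
Qed.

Lemma flexible_absorber_cat Q p P gs : size Q = 6 -> (3 <= size P)%N ->
  sqpath (adj H) Q -> sqpath (adj H) (last3 Q ++ p ++ take 3 P) ->
  flexible P gs -> flexible (Q ++ p ++ P) (Q :: gs).
Proof.
move=> Q6 hP sQ sp fP [|x o]; first by rewrite /fits.
rewrite /fits [all2 _ _ _]/= => /andP[hx /fP[s [ps ss s3 l3]]].
have hs := perm_size3 hP ps.
have hxQ : fits [:: x] [:: Q] by rewrite /fits /= hx.
have [Q' [pQ sQ' Q3 lQ3]] := flexible_absorber Q6 sQ hxQ.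
have hQ' : (3 <= size Q')%N by apply: (perm_size3 _ pQ); rewrite Q6.
exists (Q' ++ p ++ s); split.
- rewrite (perm_trans (perm_cat pQ (perm_cat (perm_refl p) ps))) // -!catA perm_cat2l.
  rewrite [in X in perm_eq _ X](_ : pmap id (x :: o) = pmap id [:: x] ++ pmap id o); last by case: x {hx hxQ pQ}.
  by rewrite !catA perm_cat2r -catA perm_catC.
- by apply: sqpath_join; rewrite ?s3 ?lQ3.
- by rewrite takel_cat // Q3 takel_cat // Q6.
- by rewrite !catA !cat_last3.
Qed.

(** Fewer members are occupied than absorb [v], so one that absorbs [v] is still free. *)
Lemma fits_extend o gs v : fits o gs ->
  (size (pmap id o) < count (fun g => absorbs H g v) gs)%N ->
  exists2 o', fits o' gs & perm_eq (pmap id o') (v :: pmap id o).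
Proof.
elim: gs o => [|g gs IHgs] [|x o] //= /andP[hx ho].
have step : (size (pmap id o) < count (fun g => absorbs H g v) gs)%N ->
    exists2 o', fits o' (g :: gs) & perm_eq (pmap id o') (v :: pmap id (x :: o)).
  move=> /(IHgs _ ho)[o' ho' po']; exists (x :: o'); first by rewrite /fits /= hx.
  case: x {hx} => [u|] //=.
  rewrite (perm_trans (_ : perm_eq _ (u :: v :: pmap id o))) ?perm_cons //.
  by rewrite -[[:: u, v & _]]/([:: u; v] ++ _) -[[:: v, u & _]]/([:: v; u] ++ _) perm_cat2r (perm_catC [:: u]).
case: x hx step => [u|] /= hx step hc.
  by apply: step; move: hc; case: absorbs => /=; rewrite ?add1n ?add0n // => /ltnW.
case hg : (absorbs H g v) hc => hc; last exact: step.
by exists (Some v :: o); rewrite /= ?perm_refl // /fits /= hg.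
Qed.

Lemma absorb P gs (m : nat) X : flexible P gs ->
  (forall v, m <= count (fun g => absorbs H g v) gs)%N -> (size X <= m)%N ->
  exists s, [/\ perm_eq s (P ++ X), sqpath (adj H) s,
    take 3 s = take 3 P & last3 s = last3 P].
Proof.
move=> fP hgs hX.
have [o ho po] : exists2 o, fits o gs & perm_eq (pmap id o) X.
  elim: X hX => [_|v X IHX hX].
    exists (nseq (size gs) None); last by elim: (gs) => //= ? ? ->.
    by rewrite /fits; elim: (gs).
  have [o ho po] := IHX (ltnW hX).
  have [|o' ho' po'] := @fits_extend o gs v ho; first by rewrite (perm_size po) (leq_trans hX).
  by exists o' => //; rewrite (perm_trans po') // perm_cons.
have [s [ps ss s3 l3]] := fP o ho; exists s; split => //.
by rewrite (perm_trans ps) // perm_cat2l.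
Qed.

End Flexible.

(** With [m = n %/ q] one has [n < q * (m + 1) <= (m + 1) ^ 2 <= 2 ^ m]. *)
Lemma lt_exp2_divn q : (0 < q)%N ->
  exists n0, forall n, (n0 <= n)%N -> (n < 2 ^ (n %/ q))%N.
Proof.
move=> q0; exists (q * (q + 6))%N => n hn.
have hm : (q + 6 <= n %/ q)%N by rewrite leq_divRL // mulnC.
have sq m : (6 <= m)%N -> (m.+1 * m.+1 <= 2 ^ m)%N.
  elim: m => // m IHm; rewrite leq_eqVlt => /orP[/eqP <- //|h6].
  by have := IHm h6; rewrite expnS; move: (2 ^ m)%N => M; nia.
have h1 := ltn_ceil n q0; apply: leq_trans h1 _.
apply: leq_trans (sq _ (leq_trans (leq_addl _ _) hm)).
by rewrite leq_mul2l (leq_trans _ (leqW hm)) ?orbT // leq_addr.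
Qed.

(** * Construction of the absorbing path *)

Section AbsorbingPath.
Variable R : realType.

(** Bernoulli's inequality for [(1 + d) ^+ j], together with [(1 - d) * (1 + d) <= 1]. *)
Lemma exists_expr_le (d e : R) : 0 < d -> d <= 1 -> 0 < e ->
  exists2 j, (0 < j)%N & (1 - d) ^+ j <= e.
Proof.
move=> d0 d1 e0; have [j hj] := exists_nat_ge ((e * d)^-1).
exists j.+1 => //; have {}hj := hj _ (leqnSn j).
have bern i : 1 + i%:R * d <= (1 + d) ^+ i.
  elim: i => [|i IHi]; first by rewrite mul0r addr0.
  rewrite exprS -natr1; apply: le_trans (_ : (1 + d) * (1 + i%:R * d) <= _).
    have : 0 <= i%:R * d * d by rewrite !mulr_ge0 // ltW.
    by move=> h; lra.
  by rewrite ler_wpM2l // addr_ge0 // ltW.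
have p0 : 0 < 1 + j.+1%:R * d by rewrite ltr_pwDl // mulr_ge0 // ltW.
rewrite -(ler_pM2r p0); apply: (@le_trans _ _ 1).
  apply: le_trans (_ : (1 - d) ^+ j.+1 * (1 + d) ^+ j.+1 <= _).
    by rewrite ler_wpM2l // exprn_ge0 // subr_ge0.
  rewrite -exprMn exprn_ile1 //; nra.
move: hj; rewrite -div1r ler_pdivrMr ?mulr_gt0 // => hj; nra.
Qed.

Implicit Types (eta mu : R) (V : finType).

(** A pair loses at most as many neighbours as vertices are deleted, and the smaller size of [W]
    only helps. *)
Lemma dense_subset V (H : hypergraph3 V) (U W : {set V}) eta eta' :
  dense H U eta -> W \subset U -> 0 <= 4 / 5 + eta' ->
  #|U|%:R - #|W|%:R <= (eta - eta') * #|U|%:R -> dense H W eta'.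
Proof.
move=> dU sWU e0 hW u v uv; have := dU u v uv.
have h1 : #|U :&: nb H u v|%:R + #|W|%:R <= #|W :&: nb H u v|%:R + #|U|%:R :> R.
  rewrite -!natrD ler_nat -(cardsUI (U :&: nb H u v) W) addnC leq_add //.
    by rewrite subset_leq_card //; apply/subsetP => x; rewrite !inE => /andP[/andP[_ ->] ->].
  by rewrite subset_leq_card // subUset subsetIl.
have h2 : #|W|%:R <= #|U|%:R :> R by rewrite ler_nat subset_leq_card.
move=> h3; nra.
Qed.

(** Length at least four guarantees that the end triples to be connected are edges. *)
Lemma connect_paths eta mu : 0 < eta -> eta <= 1 / 5 -> 0 < mu ->
  exists n0, forall V (H : hypergraph3 V) (U : {set V}),
    (n0 <= #|V|)%N -> mu * #|V|%:R <= #|U|%:R -> dense H U eta ->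
    forall Q P : seq V, (4 <= size Q)%N -> (4 <= size P)%N ->
      sqpath (adj H) Q -> sqpath (adj H) P -> uniq (last3 Q ++ take 3 P) ->
    exists p, [/\ size p = 19, uniq p, {subset p <= U} &
      sqpath (adj H) (last3 Q ++ p ++ take 3 P)].
Proof.
move=> e0 e5 m0; have [n0 h0] := connecting e0 e5 m0; exists n0 => V H U le0 hU dU Q P Q4 P4 sQ sP.
have [s0 [x [y [z [eQ ->]]]]] := last3_split (ltnW Q4).
have [a [b [c [s1 [eP ->]]]]] := take3_split (ltnW P4).
move=> u6.
have xyz : adj H x y z.
  move: Q4 sQ; rewrite eQ size_cat addnC /= => Q4.
  case/lastP: s0 {eQ} Q4 => // s0 t _; rewrite cat_rcons => /sqpath_catr /=.
  by case/andP => /and4P[].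
have abc : adj H a b c.
  by move: P4 sP; rewrite eP; case: (s1) => //= d ? _ /andP[/and4P[]].
by have [p hp] := h0 V H U le0 hU dU x y z a b c u6 xyz abc; exists p.
Qed.

Lemma uniq_last3_take3 V (Q P : seq V) : uniq (Q ++ P) -> uniq (last3 Q ++ take 3 P).
Proof.
rewrite !cat_uniq => /and3P[uQ hQP uP]; rewrite drop_uniq // take_uniq // andbT /=.
apply: contra hQP => /hasP[x /mem_take xP /mem_drop xQ].
by apply/hasP; exists x.
Qed.

(** The potential [Phi] gives a vertex weight [2 ^ (- i)] when [i] chosen absorbers absorb it. Each
    round adds an absorber that catches a proportion [c] of this weight, until no vertex can have
    few absorbers. *)
Lemma absorbing_path eta : 0 < eta -> eta <= 1 / 5 ->
  exists q n0, (0 < q)%N /\ forall V (H : hypergraph3 V), (n0 <= #|V|)%N ->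
    dense H setT eta -> exists P gs,
      [/\ uniq P, (6 <= size P)%N, (size P)%:R <= eta / 4 * #|V|%:R,
        sqpath (adj H) P & flexible H P gs] /\
      (forall v, #|V| %/ q <= count (fun g => absorbs H g v) gs)%N.
Proof.
move=> e0 e5.
have e0' : 0 < eta / 2 by rewrite divr_gt0.
have e5' : eta / 2 <= 1 / 5 by lra.
have half0 : 0 < 1 / 2 :> R by rewrite divr_gt0.
have half1 : 1 / 2 <= 1 :> R by lra.
have half2 : 1 / 4 = 1 / 2 * (1 / 2) :> R by lra.
have [n1 h1] := absorber_weight e0' e5' half0.
have [n2 h2] := connect_paths e0' e5' half0.
set c := (eta / 2 * (1 / 2)) ^+ 6 in h1.
have c0 : 0 < c by rewrite exprn_gt0 // !mulr_gt0 ?invr_gt0.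
have c1 : c <= 1 by rewrite exprn_ile1 //; nra.
clearbody c.
have c2 : 0 <= 1 - c / 2 by lra.
(* With this [j], [j * m] rounds shrink [Phi] by the factor [4 ^ (- m)]. *)
have [j j0 hj] : exists2 j, (0 < j)%N & (1 - c / 2) ^+ j <= 1 / 4.
  by apply: exists_expr_le; rewrite ?divr_gt0 //; lra.
(* A round uses at most [25 = 6 + 19] vertices, an absorber and a connector; [q] makes [j * m]
   rounds fit into [eta / 4 * n] vertices. *)
have [q q0 hq] : exists2 q, (0 < q)%N & (25 * j)%:R <= eta / 4 * q%:R.
  have [q hq] := exists_nat_ge ((25 * j)%:R / (eta / 4)).
  exists q.+1 => //; have := hq q.+1 (leqnSn _).
  by rewrite ler_pdivrMr ?divr_gt0 // mulrC.
have [n3 h3] := lt_exp2_divn q0.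
exists q, (maxn (maxn n1 n2) (maxn n3 q)); split=> // V H.
rewrite !geq_max => /andP[/andP[le1 le2] /andP[le3 leq]] dT.
set n := #|V| in le1 le2 le3 leq *; set m := (n %/ q)%N.
have m0 : (0 < m)%N by rewrite divn_gt0.
have bound i : (i <= j * m)%N -> (25 * i)%:R <= eta / 4 * n%:R.
  move=> hi; apply: (@le_trans _ _ ((25 * j)%:R * m%:R)).
    by rewrite -natrM ler_nat -mulnA leq_mul2l hi.
  apply: (@le_trans _ _ (eta / 4 * (q * m)%:R)).
    by rewrite [(q * m)%:R]natrM mulrA ler_wpM2r.
  by rewrite ler_wpM2l ?divr_ge0 ?(ltW e0) // ler_nat mulnC leq_divM.
have denseC (s : seq V) : (size s)%:R <= eta / 4 * n%:R ->
    dense H (~: [set x in s]) (eta / 2) /\ 1 / 2 * n%:R <= #|~: [set x in s]|%:R :> R.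
  move=> hs.
  have hc : #|~: [set x in s]|%:R >= n%:R - (size s)%:R :> R.
    rewrite lerBlDr -natrD ler_nat /n -(cardsC [set x in s]) addnC leq_add2l.
    by rewrite cardsE card_size.
  have en0 : 0 <= eta * n%:R by rewrite mulr_ge0 // ltW.
  have en : eta * n%:R <= 1 / 5 * n%:R by rewrite ler_wpM2r.
  split; last by lra.
  apply: (dense_subset dT); rewrite ?subsetT //; first by lra.
  by rewrite cardsT -/n; lra.
pose Phi (gs : seq (seq V)) : R := \sum_v (1 / 2) ^+ count (fun g => absorbs H g v) gs.
have Phi_gt0 gs : 0 < Phi gs.
  have n_gt0 : (0 < n)%N by rewrite (leq_trans _ leq).
  have [v _] := card_gt0P n_gt0.
  by rewrite /Phi (bigD1 v) //= ltr_pwDl ?exprn_gt0 // sumr_ge0 // => u _; rewrite exprn_ge0 // ltW.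
have PhiS Q gs : c * Phi gs <= \sum_(v | absorbs H Q v) (1 / 2) ^+ count (fun g => absorbs H g v) gs ->
    Phi (Q :: gs) <= (1 - c / 2) * Phi gs.
  move=> hQ; have -> : Phi (Q :: gs) = Phi gs - 1 / 2 *
      \sum_(v | absorbs H Q v) (1 / 2) ^+ count (fun g => absorbs H g v) gs.
    rewrite /Phi [X in 1 / 2 * X]big_mkcond mulr_sumr -sumrB; apply: eq_bigr => v _ /=.
    rewrite /= exprD; move: (_ ^+ count _ _) => x.
    by case: (absorbs H Q v); rewrite ?expr1 ?expr0; lra.
  by lra.
have iter i : (0 < i)%N -> (i <= j * m)%N -> exists P gs,
   [/\ uniq P, (size P + 19 = 25 * i)%N, sqpath (adj H) P, flexible H P gs &
    Phi gs <= n%:R * (1 - c / 2) ^+ i].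
  elim: i => // i IHi _ hi.
  have := bound _ hi.
  case: (posnP i) IHi => [-> _ _ | i0 /(_ isT (ltnW hi))[P [gs [uP sizeP pP fP hP]]] hb].
    have h0 : (size (Nil V))%:R <= eta / 4 * n%:R.
      by rewrite mulr_ge0 // ltW ?divr_gt0.
    have [dU hU] := denseC _ h0.
    have [//||s [s6 us sU ps hs]] := h1 V H _ le1 hU dU (fun=> 1).
      by have := Phi_gt0 [::]; rewrite /Phi.
    exists s, [:: s]; split; rewrite ?s6 //; first exact: flexible_absorber.
    rewrite expr1 mulrC; apply: le_trans (PhiS _ _ _) _; first exact: hs.
    by rewrite /Phi /= sumr_const expr0.
  have hPn : (size P)%:R <= eta / 4 * n%:R by apply: le_trans hb; rewrite ler_nat; clear -sizeP; lia.
  have [dU hU] := denseC P hPn.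
  have [|//|s [s6 us sU ps hs]] := h1 V H _ le1 hU dU
      (fun v => (1 / 2) ^+ count (fun g => absorbs H g v) gs).
    by move=> v; rewrite exprn_ge0 // ltW.
    exact: Phi_gt0.
  have hsP : (size (s ++ P))%:R <= eta / 4 * n%:R.
    by apply: le_trans hb; rewrite size_cat ler_nat; clear -sizeP s6; lia.
  have [dU' hU'] := denseC _ hsP.
  have usP : uniq (s ++ P).
    rewrite cat_uniq us uP andbT; apply/hasPn => x xP.
    by apply/negP => /sU; rewrite !inE xP.
  have s4 : (4 <= size s)%N by rewrite s6.
  have P4 : (4 <= size P)%N by clear -sizeP i0; lia.
  have [p [p19 up pU spp]] := h2 V H _ le2 hU' dU' s P s4 P4 ps pP (uniq_last3_take3 usP).
  exists (s ++ p ++ P), (s :: gs); split.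
  - rewrite uniq_catCA cat_uniq up usP andbT /=; apply/hasPn => x xsP.
    by apply/negP => /pU; rewrite !inE xsP.
  - by rewrite !size_cat s6 p19 mulnS -sizeP; clear; lia.
  - by apply: sqpath_join; rewrite ?s6 // ltnW.
  - by apply: flexible_absorber_cat; rewrite ?s6 // ltnW.
  rewrite exprS mulrCA; apply: le_trans (PhiS _ _ hs) _.
  by rewrite ler_wpM2l.
have jm0 : (0 < j * m)%N by rewrite muln_gt0 j0.
have [P [gs [uP sizeP pP fP hP]]] := iter _ jm0 (leqnn _).
exists P, gs; split; first split=> //.
- clear -sizeP jm0.
  by move: (j * m)%N sizeP jm0 => l; lia.
- apply: le_trans (bound _ (leqnn _)); rewrite ler_nat -sizeP; exact: leq_addr.
move=> v; rewrite leqNgt; apply/negP => lt_cm.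
(* A vertex with fewer than [m] absorbers would give [2 ^ (- m) <= Phi <= n * 4 ^ (- m)], against
   [n < 2 ^ m]. *)
have hm : (1 / 2) ^+ m <= Phi gs.
  apply: (@le_trans _ _ ((1 / 2) ^+ count (fun g => absorbs H g v) gs)).
    rewrite ler_wiXn2l ?(ltW half0) ?(ltnW lt_cm) //.
  by rewrite /Phi (bigD1 v) //= lerDl sumr_ge0 // => u _; rewrite exprn_ge0 // ltW.
have := le_trans hm hP; rewrite exprM => hm'.
have h4 : (1 - c / 2) ^+ j ^+ m <= (1 / 2) ^+ m * (1 / 2) ^+ m.
  by rewrite -exprMn -half2 lerXn2r ?nnegrE ?exprn_ge0 ?divr_ge0.
have p2 : 0 < (1 / 2) ^+ m :> R by rewrite exprn_gt0.
have : (1 / 2) ^+ m <= n%:R * ((1 / 2) ^+ m * (1 / 2) ^+ m) :> R.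
  by apply: le_trans hm' _; rewrite ler_wpM2l.
rewrite mulrA -{1}[_ ^+ m]mul1r ler_pM2r // div1r exprVn ler_pdivlMr ?exprn_gt0 // mul1r.
by rewrite -natrX ler_nat leqNgt h3.
Qed.

End AbsorbingPath.

(** * Tiles of small weight *)

Section Tile.
Variable R : realType.
Implicit Types (eta mu : R) (V : finType).

(** A lightest remaining vertex is added repeatedly, and its weight becomes the threshold [a]. *)
Lemma lowest_weights V (U : {set V}) (w : V -> R) m :
  (forall v, 0 <= w v) -> (m <= #|U|)%N ->
  exists (S : {set V}) (a : R), [/\ S \subset U, #|S| = m, 0 <= a,
    {in S, forall x, w x <= a} & {in U :\: S, forall y, a <= w y}].
Proof.
move=> w0; elim: m => [|m IHm] hm.
  by exists set0, 0; split; rewrite ?sub0set ?cards0 // => x; rewrite inE.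
have [S [a [sSU cS a0 hS hU]]] := IHm (ltnW hm).
have [y0 y0U] : exists y, y \in U :\: S.
  by apply/card_gt0P; rewrite cardsD (setIidPr sSU) cS subn_gt0.
have [y yU ymin] : exists2 y, y \in U :\: S & {in U :\: S, forall z, w y <= w z}.
  by case: (arg_minP w y0U) => y yU ymin; exists y.
move: (yU); rewrite inE => /andP[yS yU'].
exists (y |: S), (w y); split=> //.
- by rewrite subUset sub1set sSU andbT.
- by rewrite cardsU1 cS yS.
- by move=> x; rewrite !inE => /predU1P[->//|/hS/le_trans]; apply; apply: hU.
- by move=> x; rewrite !inE negb_or -andbA => /and3P[_ xS xU]; apply: ymin; rewrite inE xS.
Qed.

Lemma rich_subset V (H : hypergraph3 V) (U S : {set V}) j (d : R) :
  rich H U j d -> S \subset U -> rich H S j (d + #|S|%:R - #|U|%:R).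
Proof.
move=> hU sSU qs sqs dqs; rewrite lerBlDr; apply: le_trans (_ : #|[set x in U | all (fun q => adj H q.1 q.2 x) qs]|%:R + #|S|%:R <= _).
  by rewrite lerD2r hU.
rewrite -!natrD ler_nat -cardsUI addnC leq_add ?subset_leq_card //.
  by apply/subsetP => x; rewrite !inE => /andP[/andP[_ ->] ->].
by rewrite subUset sSU andbT; apply/subsetP => x; rewrite inE => /andP[].
Qed.

(** The word runs [t] times round the four parts, so four consecutive entries lie in different
    parts. *)
Definition tile_word t := [seq (i, j) | j <- iota 0 t, i <- iota 0 4].

Definition tile_conds : seq (seq (nat * nat)) :=
  [:: [::]; [::]; [:: (0, 1)]; [:: (0, 1); (0, 2); (1, 2)]]%N.

Lemma tile_word_sqpath t : sqpath (word_edge 0 [::] tile_conds) (tile_word t).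
Proof.
suff gen k : sqpath (word_edge 0 [::] tile_conds)
  [seq (i, j) | j <- iota k t, i <- iota 0 4] by exact: gen.
elim: t k => // -[//|t] IHt k.
by have /= -> := IHt k.+1.
Qed.

Lemma tile_word_uniq t : uniq (tile_word t).
Proof. by apply: allpairs_uniq; rewrite ?iota_uniq // => -[j i] [j' i'] _ _ [-> ->]. Qed.

(* The first two parts of the tile are taken among the lightest [gam]-fraction of [U],
   the third among the lightest fifth and the fourth among the lightest three fifths;
   if [a <= b <= c] are the corresponding weight thresholds, then [2a + b + c] is at
   most four times the average weight, up to [gam]. *)
Lemma light_tile eta mu gam t :
  0 < eta -> eta <= 1 / 5 -> 0 < mu -> 0 < gam -> gam <= 1 / 10 -> (0 < t)%N ->
  exists n0, forall V (H : hypergraph3 V) (U : {set V}),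
    (n0 <= #|V|)%N -> mu * #|V|%:R <= #|U|%:R -> dense H U eta ->
    forall w : V -> R, (forall v, 0 <= w v) ->
    exists Q, [/\ size Q = (4 * t)%N, uniq Q, {subset Q <= U}, sqpath (adj H) Q &
      (\sum_(x <- Q) w x) * #|U|%:R <= (1 + 2 * gam) * (4 * t)%:R * \sum_(x in U) w x].
Proof.
move=> e0 e5 m0 g0 g1 t0.
have c0 : 0 < gam * eta * mu by rewrite !mulr_gt0.
have c40 : 0 < (gam * eta * mu) ^+ 4 by rewrite exprn_gt0.
have [n1 h1] := dense_tuples_blowup 4 t c40.
have [n2 h2] := exists_nat_ge (10 / (gam * eta * mu)).
exists (maxn n1 n2) => V H U; rewrite geq_max => /andP[le1 /h2 hn] hU dU w w0.
rewrite ler_pdivrMr // in hn; clear h2 n2.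
set r := #|U| in hU *; set n := #|V| in le1 hn hU *.
have hr1 : gam * eta * mu * n%:R <= gam * eta * r%:R by rewrite -mulrA ler_pM2l ?mulr_gt0.
have gr0 : 0 <= gam * r%:R by rewrite mulr_ge0 // ltW.
have er0 : 0 <= eta * r%:R by rewrite mulr_ge0 // ltW.
have hger : gam * r%:R * eta <= gam * r%:R * (1 / 5) by rewrite ler_wpM2l.
have hger' : eta * r%:R * gam <= eta * r%:R * (1 / 10) by rewrite ler_wpM2l.
have her : eta * r%:R <= 1 / 5 * r%:R by rewrite ler_wpM2r.
have hgr : gam * r%:R <= 1 / 10 * r%:R by rewrite ler_wpM2r.
have [mA [mA1 mA2]] : exists mA, mA%:R <= gam * r%:R /\ gam * r%:R <= mA%:R + 1.
  exists (Num.trunc (gam * r%:R)).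
  have /truncn_itv/andP[h h'] := gr0.
  by rewrite h natr1 ltW.
have divn_bounds x : ((x %/ 5)%:R * 5 <= x%:R :> R) /\ (x%:R <= ((x %/ 5)%:R + 1) * 5 :> R).
  by rewrite natr1 -!natrM !ler_nat leq_divM ltnW // ltn_ceil.
have [mB1 mB2] := divn_bounds r; set mB := (r %/ 5)%N in mB1 mB2.
have [mC1 mC2] := divn_bounds (3 * r)%N; set mC := (3 * r %/ 5)%N in mC1 mC2.
rewrite natrM in mC1 mC2; clearbody mB mC; clear divn_bounds.
have ltAB : (mA < mB)%N by rewrite -(ltr_nat R); lra.
have ltBC : (mB < mC)%N by rewrite -(ltr_nat R); lra.
have leC : (mC <= r)%N by rewrite -(ler_nat R); lra.
have leB := leq_trans (ltnW ltBC) leC; have leA := leq_trans (ltnW ltAB) leB.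
have [SA [a [sA cA a0 hA hA']]] := lowest_weights w0 leA.
have [SB [b [sB cB b0 hB hB']]] := lowest_weights w0 leB.
have [SC [c [sC cC c0' hC hC']]] := lowest_weights w0 leC.
have mono (S1 S2 : {set V}) (a1 a2 : R) : (#|S1| < #|S2|)%N -> S2 \subset U ->
    {in U :\: S1, forall y, a1 <= w y} -> {in S2, forall x, w x <= a2} -> a1 <= a2.
  move=> lt12 s2 h1' h2'; have [x xS2 xS1] : exists2 x, x \in S2 & x \notin S1.
    apply/subsetPn; apply: contraL lt12 => /subset_leq_card; by rewrite -leqNgt.
  by apply: le_trans (h1' x _) (h2' x xS2); rewrite inE xS1 (subsetP s2).
have ab : a <= b by apply: (mono SA SB) => //; rewrite cA cB.
have bc : b <= c by apply: (mono SB SC) => //; rewrite cB cC.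
(* A fifth of [U] withstands one pair condition and three fifths withstand three, leaving about
   [eta * r] and [3 * eta * r] candidates. *)
pose st := [:: (SA, [::]); (SA, [::]); (SB, [:: (0, 1)]); (SC, [:: (0, 1); (0, 2); (1, 2)])]%N.
have cnt : (gam * eta * mu * n%:R) ^+ 4 <= #|[set s : 4.-tuple V | admissible H st [::] s]|%:R.
  apply: (@admissible_count V H R _ st) => //; first by lra.
  move=> U' ps; rewrite /= add0n => hin qs sqs dqs.
  have rU j := dense_rich (j := j) dU.
  move: hin; rewrite !inE => /or4P[] /eqP[eU eps]; subst U' ps.
  - apply: le_trans (rich_subset (@rU 0%N) sA sqs dqs).
    by rewrite cA mul0r subr0 mul1r; lra.
  - apply: le_trans (rich_subset (@rU 0%N) sA sqs dqs).
    by rewrite cA mul0r subr0 mul1r; lra.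
  - apply: le_trans (rich_subset (@rU 1%N) sB sqs dqs).
    by rewrite cB -/r; lra.
  - apply: le_trans (rich_subset (@rU 3%N) sC sqs dqs).
    by rewrite cC -/r; lra.
rewrite exprMn in cnt.
have [A [szA uA adA]] := h1 V _ le1 cnt.
have [x0 _] : exists x, x \in U by apply/card_gt0P; rewrite -/r (leq_trans _ leB) // (leq_trans _ ltAB).
pose g := lift_letter x0 [::] A.
have okw : all (letter_ok 0 4 t) (tile_word t).
  by apply/allP => p /allpairsPdep[j [i [+ + ->]]]; rewrite !mem_iota /letter_ok /= => -> ->.
have gS p : p \in tile_word t -> g p \in nth set0 [:: SA; SA; SB; SC] p.1.
  move=> pin; have /andP[_ /andP[pk pt]] := allP okw p pin.
  by have := @lift_letter_mem V H x0 t st [::] A szA uA adA p isT pk pt; rewrite subn0.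
exists (map g (tile_word t)); split.
- by rewrite size_map size_allpairs !size_iota mulnC.
- rewrite map_inj_in_uniq ?tile_word_uniq // => p q pin qin.
  by apply: (@lift_letter_inj V H x0 t st [::] A) => //; rewrite unfold_in; apply: (allP okw).
- move=> v /mapP[p /gS + ->].
  case: (p.1) => [|[|[|[|i]]]] /=.
  + exact: (subsetP sA).
  + exact: (subsetP sA).
  + exact: (subsetP sB).
  + exact: (subsetP sC).
  + by rewrite nth_nil inE.
- exact: (@lift_letter_sqpath V H x0 t st [::] A t0 szA uA adA [::] _ isT isT isT okw (tile_word_sqpath t)).
(* Layer by layer: [w] is at least [a], [b], [c] outside [SA], [SB], [SC] respectively. *)
have hW : a * (r%:R - mA%:R) + (b - a) * (r%:R - mB%:R) + (c - b) * (r%:R - mC%:R) <= \sum_(x in U) w x.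
  have cardD (S : {set V}) m (d : R) : S \subset U -> #|S| = m ->
      d * (r%:R - m%:R) = \sum_(x in U) (if x \in S then 0 else d).
    move=> sS cS; rewrite (bigID (mem S)) /= big1 ?add0r; last by move=> x /andP[_ ->].
    rewrite (eq_bigr (fun=> d)); last by move=> x /andP[_ /negPf->].
    rewrite -cS -natrB ?subset_leq_card // mulr_natr sumr_const; congr (_ *+ _).
    rewrite -(setIidPr sS) -cardsD (setIidPr sS); apply: eq_card => x.
    by rewrite !inE [RHS]andbC.
  rewrite (cardD SA) // (cardD SB) // (cardD SC) // -!big_split /=.
  apply: ler_sum => x xU; clear -hA' hB' hC' ab bc a0 w0 xU.
  have hx (S : {set V}) (d : R) : {in U :\: S, forall y, d <= w y} -> x \notin S -> d <= w x.
    by move=> hS xS; apply: hS; rewrite inE xS.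
  case: ifPn => [_|/(hx _ _ hA') h1']; case: ifPn => [_|/(hx _ _ hB') h2'];
    case: ifPn => [_|/(hx _ _ hC') h3']; have := w0 x; lra.
have hQ : \sum_(x <- map g (tile_word t)) w x <= t%:R * (2 * a + b + c).
  pose bnd i := nth 0 [:: a; a; b; c] i.
  rewrite big_map; apply: le_trans (_ : \sum_(p <- tile_word t) bnd p.1 <= _).
    rewrite big_seq [leRHS]big_seq; apply: ler_sum => p pin; have := gS p pin; rewrite /bnd.
    case: (p.1) => [|[|[|[|i]]]] /=; [exact: hA|exact: hA|exact: hB|exact: hC|].
    by rewrite nth_nil inE.
  rewrite /tile_word big_allpairs_dep /= big_const_seq count_predT size_iota.
  by rewrite !big_cons big_nil /bnd /= iter_addr addr0 -mulr_natl; clear; lra.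
have hQr : (\sum_(x <- map g (tile_word t)) w x) * r%:R <= t%:R * (2 * a + b + c) * r%:R.
  by rewrite ler_wpM2r.
apply: le_trans hQr _.
rewrite natrM [(1 + 2 * gam) * _]mulrC -!mulrA [X in _ <= X]mulrCA ler_wpM2l //.
set W := \sum_(x in U) w x in hW *.
have r0 : 0 <= r%:R :> R by [].
have p1 : (b - a) * mB%:R <= (b - a) * (r%:R / 5) by rewrite ler_wpM2l ?subr_ge0 //; lra.
have p2 : (c - b) * mC%:R <= (c - b) * (3 * r%:R / 5) by rewrite ler_wpM2l ?subr_ge0 //; lra.
have p3 : a * mA%:R <= a * (gam * r%:R) by rewrite ler_wpM2l.
have q1 : 0 <= (b - a) * r%:R by rewrite mulr_ge0 ?subr_ge0.
have q2 : 0 <= (c - b) * r%:R by rewrite mulr_ge0 ?subr_ge0.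
have q3 : 0 <= a * r%:R by rewrite mulr_ge0.
(* As [2 * a + b + c = 4 * a + 2 * (b - a) + (c - b)], four times this bound suffices; only the term
   in [a] needs the factor [1 + 2 * gam]. *)
have hW' : a * r%:R * (1 - gam) + (b - a) * r%:R * (4 / 5) + (c - b) * r%:R * (2 / 5) <= W by lra.
have hg0 : 0 <= 1 + 2 * gam by lra.
have hW2 := ler_wpM2l hg0 hW'.
have q4 : 0 <= a * r%:R * (gam * (1 - 2 * gam)) by rewrite mulr_ge0 // mulr_ge0 ?(ltW g0) //; lra.
have q5 : 0 <= (b - a) * r%:R * gam by rewrite mulr_ge0 // ltW.
have q6 : 0 <= (c - b) * r%:R * gam by rewrite mulr_ge0 // ltW.
clear -hW2 q1 q2 q3 q4 q5 q6; lra.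
Qed.

End Tile.

(** * The almost covering path *)

Section Potential.
Variable R : realType.
Implicit Types (eta mu K : R) (V : finType).

(** From [1 - y <= expR (- y)] one gets [expR y <= 1 / (1 - y)]. *)
Lemma expR_le_quadratic (y : R) : y <= 1 / 2 -> expR y <= 1 + y + 2 * y ^+ 2.
Proof.
move=> hy; have := expR_ge1Dx (- y); rewrite expRN => h.
have e0 := expR_gt0 y; have y0 : 0 < 1 - y by lra.
have : (1 - y) * expR y <= 1.
  by rewrite -[leRHS](mulVf (lt0r_neq0 e0)) ler_pM2r.
rewrite -ler_pdivlMl // => /le_trans; apply.
rewrite ler_pdivrMl // -subr_ge0.
have -> : (1 - y) * (1 + y + 2 * y ^+ 2) - 1 = y ^+ 2 * (1 - 2 * y) by ring.
by rewrite mulr_ge0 ?sqr_ge0 //; lra.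
Qed.

Lemma sqr_le_expR (c : R) : 0 < c -> exists n0, forall n, (n0 <= n)%N ->
  n%:R ^+ 2 <= expR (c * n%:R).
Proof.
move=> c0; have [n0 h0] := exists_nat_ge ((3 / c) ^+ 3).
exists n0 => n /h0 hn; have n_ge0 : 0 <= n%:R :> R by [].
have h1 : c * n%:R / 3 <= expR (c * n%:R / 3).
  by apply: le_trans (expR_ge1Dx _); rewrite lerDr.
have cn0 : 0 <= c * n%:R / 3 by rewrite divr_ge0 // mulr_ge0 // ltW.
have -> : c * n%:R = 3%:R * (c * n%:R / 3) by field.
rewrite expRM_natl; apply: le_trans (_ : (c * n%:R / 3) ^+ 3 <= _).
  have h2 : (3 / c) ^+ 3 * (c / 3) ^+ 3 = 1.
    by field; rewrite gt_eqF.
  have h3 : n%:R ^+ 2 * ((3 / c) ^+ 3 * (c / 3) ^+ 3) <= n%:R ^+ 2 * (n%:R * (c / 3) ^+ 3).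
    by rewrite ler_wpM2l ?exprn_ge0 // ler_wpM2r // exprn_ge0 // divr_ge0 // ltW.
  rewrite h2 mulr1 in h3; apply: le_trans h3 _.
  have -> : (c * n%:R / 3) ^+ 3 = n%:R ^+ 2 * (n%:R * (c / 3) ^+ 3) by field.
  exact: lexx.
by rewrite lerXn2r // nnegrE ltW ?expR_gt0.
Qed.

Variables (V : finType) (H : hypergraph3 V).
Implicit Types (U J : {set V}) (p : V * V).

Definition pair_weight K U p : R :=
  expR (- (K * #|U :&: nb H p.1 p.2|%:R / #|U|%:R)).

Definition potential K U := \sum_(p : V * V | p.1 != p.2) pair_weight K U p.

(** To first order, removing vertices raises the potential in proportion to the excess of their
    weight over the average. *)
Definition vertex_weight K U x :=
  \sum_(p : V * V | (p.1 != p.2) && (x \in nb H p.1 p.2)) pair_weight K U p.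

Lemma sum_vertex_weight K U J :
  \sum_(x in J) vertex_weight K U x =
  \sum_(p : V * V | p.1 != p.2) pair_weight K U p * #|J :&: nb H p.1 p.2|%:R.
Proof.
rewrite (exchange_big_dep (fun p : V * V => p.1 != p.2)) /=; last by move=> ? ? _ /andP[].
apply: eq_bigr => p p12; rewrite (eq_bigl (fun x => x \in J :&: nb H p.1 p.2)).
  by rewrite sumr_const mulr_natr.
by move=> x; rewrite in_setI p12.
Qed.

(** Each exponent changes by some [y] with [|y| <= B]; the linear terms add up to the excess weight
    of [J], the quadratic ones give [2 * B ^+ 2]. *)
Lemma potential_step K U J (B : R) : 0 < K -> J \subset U -> (#|J| < #|U|)%N ->
  K * #|J|%:R <= B * (#|U|%:R - #|J|%:R) -> B <= 1 / 2 ->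
  potential K (U :\: J) <= (1 + 2 * B ^+ 2) * potential K U +
    K / (#|U|%:R - #|J|%:R) * (\sum_(x in J) vertex_weight K U x -
      #|J|%:R / #|U|%:R * \sum_(x in U) vertex_weight K U x).
Proof.
move=> K0 sJU ltJU hB B2.
set r : R := #|U|%:R in hB *; set s : R := #|J|%:R in hB *.
have rs : 0 < r - s by rewrite subr_gt0 ltr_nat.
have s0 : 0 <= s by rewrite ler0n.
have r0 : 0 < r by apply: le_lt_trans (_ : s < r); rewrite // -subr_gt0.
rewrite !sum_vertex_weight mulrBr !mulr_sumr -sumrB -big_split /=; apply: ler_sum => p p12.
set f := pair_weight K U p; set d : R := #|U :&: nb H p.1 p.2|%:R; set q : R := #|J :&: nb H p.1 p.2|%:R.
have d0 : 0 <= d by rewrite ler0n.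
have dr : d <= r by rewrite ler_nat subset_leq_card // subsetIl.
have q0 : 0 <= q by rewrite ler0n.
have qs : q <= s by rewrite ler_nat subset_leq_card // subsetIl.
have f0 : 0 < f by apply: expR_gt0.
pose y := K / (r - s) * (q - s / r * d).
have sd0 : 0 <= s / r * d by rewrite mulr_ge0 // divr_ge0 // ltW.
have sd1 : s / r * d <= s by rewrite mulrAC ler_pdivrMr // ler_wpM2l.
have Ks0 : 0 <= K / (r - s) by rewrite divr_ge0 // ltW.
have KsB : K / (r - s) * s <= B by rewrite mulrAC ler_pdivrMr.
have y1 : y <= B by apply: le_trans KsB; rewrite ler_wpM2l //; lra.
have y2 : - B <= y.
  apply: le_trans (_ : K / (r - s) * (- s) <= _); first by rewrite mulrN lerN2.
  by rewrite ler_wpM2l //; lra.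
have -> : pair_weight K (U :\: J) p = f * expR y.
  rewrite /f /pair_weight -expRD; congr expR.
  have -> : #|U :\: J|%:R = r - s.
    by rewrite cardsD (setIidPr sJU) natrB // subset_leq_card.
  have -> : #|(U :\: J) :&: nb H p.1 p.2|%:R = d - q.
    rewrite /d /q -natrB ?subset_leq_card ?setSI //; congr (_%:R).
    have -> : (U :\: J) :&: nb H p.1 p.2 = (U :&: nb H p.1 p.2) :\: (J :&: nb H p.1 p.2).
      by apply/setP => x; rewrite !inE; case: (x \in J); case: (x \in U); rewrite /= ?andbF //; case: adj.
    by rewrite cardsD (setIidPr (setSI _ sJU)).
  by rewrite /y -/d -/r; field; rewrite !gt_eqF.
have hy : expR y <= 1 + y + 2 * B ^+ 2.
  apply: le_trans (expR_le_quadratic _) _; first by lra.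
  by rewrite lerD2l ler_wpM2l // -[y ^+ 2]real_normK ?num_real // lerXn2r ?nnegrE ?normr_ge0 // ?ler_norml ?y1 ?y2 //; lra.
have := ler_wpM2l (ltW f0) hy; move=> /le_trans; apply.
rewrite le_eqVlt; apply/orP; left; apply/eqP.
by rewrite -/f -/q -/d /y; ring.
Qed.

End Potential.

(** * Swallowing tiles while the potential stays under control *)

Section Cover.
Variable R : realType.
Implicit Types (eta mu K : R) (V : finType).

Lemma potential_ge0 V (H : hypergraph3 V) K (U : {set V}) : 0 <= potential H K U.
Proof. by apply: sumr_ge0 => p _; apply: ltW; apply: expR_gt0. Qed.

Lemma vertex_weight_ge0 V (H : hypergraph3 V) K (U : {set V}) x : 0 <= vertex_weight H K U x.
Proof. by apply: sumr_ge0 => p _; apply: ltW; apply: expR_gt0. Qed.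

Lemma vertex_weight_le V (H : hypergraph3 V) K (U : {set V}) x :
  vertex_weight H K U x <= potential H K U.
Proof.
rewrite /vertex_weight big_mkcondr /=; apply: ler_sum => p _; case: ifP => // _.
exact/ltW/expR_gt0.
Qed.

(** A pair with too few neighbours in [U] would exceed the bound by its own term. *)
Lemma dense_of_potential V (H : hypergraph3 V) K (U : {set V}) (theta : R) : 0 < K ->
  potential H K U <= expR (- (K * theta)) -> dense H U (theta - 4 / 5).
Proof.
move=> K0 hP u v uv; have -> : 4 / 5 + (theta - 4 / 5) = theta by lra.
have [U0|Upos] := posnP #|U|; first by rewrite U0 mulr0.
have : pair_weight H K U (u, v) <= expR (- (K * theta)).
  apply: le_trans hP; rewrite /potential (bigD1 (u, v)) //= lerDl.
  by apply: sumr_ge0 => p _; apply: ltW; apply: expR_gt0.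
rewrite /pair_weight ler_expR lerN2 /= -mulrA ler_pM2l //.
by rewrite ler_pdivlMr // ltr0n.
Qed.

Lemma potential_le V (H : hypergraph3 V) K (U : {set V}) (theta : R) : 0 < K -> (0 < #|U|)%N ->
  dense H U (theta - 4 / 5) ->
  potential H K U <= #|V|%:R ^+ 2 * expR (- (K * theta)).
Proof.
move=> K0 U0 dU; apply: le_trans (_ : \sum_(p : V * V) expR (- (K * theta)) <= _).
  rewrite /potential big_mkcond; apply: ler_sum => p _; case: ifP => [p12|_]; last exact/ltW/expR_gt0.
  rewrite /pair_weight ler_expR lerN2 -mulrA ler_pM2l // ler_pdivlMr ?ltr0n //.
  by have := dU _ _ p12; have -> : 4 / 5 + (theta - 4 / 5) = theta by lra.
by rewrite sumr_const card_prod -[leLHS]mulr_natl natrM -expr2.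
Qed.

(** A tile that is light for [vertex_weight] is connected to the front of [P]. It exceeds the
    average by at most [8 * gam * t] times the potential; each of the 19 connecting vertices weighs
    at most the whole potential. *)
Lemma cover_step eta mu gam t (B kap : R) :
  0 < eta -> eta <= 1 / 5 -> 0 < mu -> 0 < gam -> gam <= 1 / 10 -> (0 < t)%N ->
  0 < kap -> B <= 1 / 2 -> kap * (4 * t + 19)%:R <= B * mu ->
  exists n0, forall V (H : hypergraph3 V) (P : seq V) gs,
    (n0 <= #|V|)%N ->
    let U := ~: [set x in P] in
    mu * #|V|%:R + (4 * t + 19)%:R <= #|U|%:R -> dense H U eta ->
    uniq P -> (6 <= size P)%N -> sqpath (adj H) P -> flexible H P gs ->
    exists P', let U' := ~: [set x in P'] in
      [/\ uniq P', (6 <= size P')%N, sqpath (adj H) P' & flexible H P' gs] /\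
      (#|U'| + (4 * t + 19) = #|U|)%N /\
      potential H (kap * #|V|%:R) U' <=
        (1 + (2 * B ^+ 2 + kap / mu * (8 * gam * t%:R + 19))) * potential H (kap * #|V|%:R) U.
Proof.
move=> e0 e5 m0 g0 g1 t0 k0 B2 hB.
have e0' : 0 < eta / 2 by rewrite divr_gt0.
have e5' : eta / 2 <= 1 / 5 by lra.
have [n1 h1] := light_tile e0 e5 m0 g0 g1 t0.
have [n2 h2] := connect_paths e0' e5' m0.
have [n3 h3] := exists_nat_ge ((4 * t)%:R / (eta / 2 * mu)).
exists (maxn n1 (maxn n2 (maxn n3 1))) => V H P gs; rewrite !geq_max => /and4P[le1 le2 le3 V0] U hU dU uP P6 sP fP.
have {}h3 := h3 _ le3; rewrite ler_pdivrMr ?(mulr_gt0 e0' m0) // in h3.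
set n := #|V| in le1 le2 le3 V0 hU h3 *.
have n0 : 0 < n%:R :> R by rewrite ltr0n.
set s := (4 * t + 19)%N in hB hU *; set K := kap * n%:R.
have K0 : 0 < K by rewrite mulr_gt0.
have muU : mu * n%:R <= #|U|%:R by apply: le_trans hU; rewrite lerDl.
pose w := vertex_weight H K U.
have w0 v : 0 <= w v by apply: vertex_weight_ge0.
have [Q [sQ uQ QU pQ wQ]] := h1 V H U le1 muU dU w w0.
have QU' : [set x in Q] \subset U by apply/subsetP => x; rewrite inE; apply: QU.
have cQ : #|[set x in Q]| = (4 * t)%N by rewrite cardsE (card_uniqP uQ).
pose W := U :\: [set x in Q].
have cW : #|W|%:R = #|U|%:R - (4 * t)%:R :> R.
  by rewrite cardsD (setIidPr QU') cQ natrB // -cQ subset_leq_card.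
have s_ge : (4 * t)%:R <= s%:R :> R by rewrite ler_nat leq_addr.
have dW : dense H W (eta / 2).
  apply: (dense_subset dU); rewrite ?subsetDl //; first by lra.
  have : eta / 2 * (mu * n%:R) <= eta / 2 * #|U|%:R by rewrite ler_wpM2l // ltW.
  by rewrite cW; lra.
have muW : mu * n%:R <= #|W|%:R by rewrite cW; lra.
have uQP : uniq (Q ++ P).
  rewrite cat_uniq uQ uP andbT; apply/hasPn => x xP.
  by apply/negP => /QU; rewrite !inE xP.
have Q4 : (4 <= size Q)%N by rewrite sQ leq_pmulr.
have P4 : (4 <= size P)%N by apply: leq_trans P6.
have [p [p19 up pW spp]] := h2 V H W le2 muW dW Q P Q4 P4 pQ sP (uniq_last3_take3 uQP).
have Q3 := ltnW Q4; have P3 := ltnW P4.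
have uQpP : uniq (Q ++ p ++ P).
  rewrite uniq_catCA cat_uniq up uQP andbT; apply/hasPn => x xQP.
  by apply/negP => /pW; move: xQP; rewrite mem_cat !inE => /orP[] -> //; rewrite andbF.
exists (Q ++ p ++ P) => /=.
set U' := ~: _; pose J := [set x in Q ++ p].
have cJ : #|J| = s.
  rewrite cardsE (card_uniqP _) ?size_cat ?sQ ?p19 //.
  by move: uQpP; rewrite catA cat_uniq => /andP[].
have JU : J \subset U.
  apply/subsetP => x; rewrite inE mem_cat => /orP[/QU//|/pW].
  by rewrite inE => /andP[].
have eU' : U' = U :\: J.
  by apply/setP => x; rewrite !inE !mem_cat !negb_or; do !case: (_ \in _).
have cU' : (#|U'| + s = #|U|)%N.
  by rewrite eU' cardsD (setIidPr JU) cJ subnK // -cJ subset_leq_card.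
split; first split => //.
- by rewrite !size_cat addnA (leq_trans P6) // leq_addl.
- exact: sqpath_join.
- exact: flexible_cat.
split=> //; rewrite eU'.
have ltJ : (#|J| < #|U|)%N.
  rewrite -(ltr_nat R) cJ; apply: lt_le_trans hU; rewrite ltrDr mulr_gt0 //.
have hrs : mu * n%:R <= #|U|%:R - #|J|%:R by rewrite cJ; lra.
have s0 : 0 < s%:R :> R by rewrite ltr0n /s addn_gt0 orbT.
have mn0 : 0 < mu * n%:R by rewrite mulr_gt0.
have rs0 : 0 < #|U|%:R - #|J|%:R :> R by apply: lt_le_trans hrs.
have B0 : 0 <= B.
  have : 0 < B * mu by apply: lt_le_trans hB; rewrite mulr_gt0.
  by rewrite pmulr_lgt0 // => /ltW.
have hKB : K * #|J|%:R <= B * (#|U|%:R - #|J|%:R).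
  apply: le_trans (_ : B * (mu * n%:R) <= _); last by rewrite ler_wpM2l.
  by rewrite cJ /K mulrAC mulrA ler_wpM2r // ltW.
apply: le_trans (potential_step H K0 JU ltJ hKB B2) _.
rewrite [in leRHS]addrA [leRHS]mulrDl lerD2l.
set Phi := potential H K U; have Phi0 : 0 <= Phi by apply: potential_ge0.
have r0 : 0 < #|U|%:R :> R by apply: lt_le_trans muU.
set X := (\sum_(x in U) w x) / #|U|%:R.
have X0 : 0 <= X by rewrite divr_ge0 // sumr_ge0.
have XPhi : X <= Phi.
  rewrite ler_pdivrMr // mulrC mulr_natl -sumr_const ler_sum // => x _.
  exact: vertex_weight_le.
have hQ : \sum_(x <- Q) w x <= (1 + 2 * gam) * (4 * t)%:R * X by rewrite mulrA ler_pdivlMr.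
have hp : \sum_(x <- p) w x <= 19 * Phi.
  apply: le_trans (_ : \sum_(x <- p) Phi <= _).
    by apply: ler_sum => x _; apply: vertex_weight_le.
  by rewrite big_const_seq count_predT p19 iter_addr addr0 mulr_natl.
have eJ : \sum_(x in J) w x = \sum_(x <- Q) w x + \sum_(x <- p) w x.
  rewrite -big_cat big_uniq /=; first by apply: eq_bigl => x; rewrite inE.
  by move: uQpP; rewrite catA cat_uniq => /andP[].
have key : \sum_(x in J) w x - #|J|%:R / #|U|%:R * \sum_(x in U) w x <= (8 * gam * t%:R + 19) * Phi.
  have -> : #|J|%:R / #|U|%:R * \sum_(x in U) w x = s%:R * X by rewrite cJ /X mulrAC mulrA.
  rewrite eJ; have h4 : (4 * t)%:R * X <= s%:R * X by rewrite ler_wpM2r.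
  have h5 : (gam * t%:R) * X <= (gam * t%:R) * Phi by rewrite ler_wpM2l // mulr_ge0 // ltW.
  rewrite natrM in hQ h4; clear -hQ hp h4 h5; lra.
have c0 : 0 <= 8 * gam * t%:R + 19 by rewrite addr_ge0 // !mulr_ge0 // ltW.
apply: le_trans (_ : K / (#|U|%:R - #|J|%:R) * ((8 * gam * t%:R + 19) * Phi) <= _).
  by rewrite ler_wpM2l // divr_ge0 // ltW.
rewrite mulrA ler_wpM2r // ler_wpM2r // ler_pdivrMr //.
apply: le_trans (_ : kap / mu * (mu * n%:R) <= _).
  by rewrite mulrA divfK ?gt_eqF.
by rewrite ler_wpM2l // divr_ge0 // ltW.
Qed.

(** Initially the exponent has margin [3 / 4 * eta]. The factor [n ^ 2] and the growth over all
    rounds cost at most [K * eta / 16] each, so density [eta / 2] persists. *)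
Lemma almost_cover eta mu : 0 < eta -> eta <= 1 / 5 -> 0 < mu -> mu <= 1 / 2 ->
  exists s n0 : nat, forall V (H : hypergraph3 V) (P : seq V) gs,
    (n0 <= #|V|)%N -> dense H setT eta ->
    uniq P -> (6 <= size P)%N -> (size P)%:R <= eta / 4 * #|V|%:R ->
    sqpath (adj H) P -> flexible H P gs ->
    exists P', let U := ~: [set x in P'] in
      [/\ uniq P', (6 <= size P')%N, sqpath (adj H) P' & flexible H P' gs] /\
      [/\ dense H U (eta / 2), mu * #|V|%:R <= #|U|%:R &
        #|U|%:R <= mu * #|V|%:R + s%:R].
Proof.
move=> e0 e5 m0 m1.
have em0 : 0 < eta * mu by rewrite mulr_gt0.
have em1 : eta * mu <= 1 / 5 * (1 / 2) by apply: ler_pM => //; apply: ltW.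
pose gam := eta * mu / 96.
(* This makes [19 <= 8 * gam * t]: the connector costs no more than the excess of the tile. *)
have [t t0 ht] : exists2 t, (0 < t)%N & 228 <= t%:R * (eta * mu).
  have [t0 ht] := exists_nat_ge (228 / (eta * mu)).
  by exists t0.+1 => //; have := ht _ (leqnSn t0); rewrite ler_pdivrMr.
pose s := (4 * t + 19)%N; exists s.
have s0 : 0 < s%:R :> R by rewrite ltr0n /s addn_gt0 orbT.
(* With [K = kap * n], removing [s] vertices changes each exponent by at most [gam], the value used
   for [B]. *)
pose kap := gam * mu / s%:R.
have g0 : 0 < gam by rewrite divr_gt0.
have g1 : gam <= 1 / 10 by rewrite /gam; lra.
have k0 : 0 < kap by apply: divr_gt0 => //; apply: mulr_gt0.
have e0' : 0 < eta / 2 by rewrite divr_gt0.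
have e5' : eta / 2 <= 1 / 5 by lra.
have B2 : gam <= 1 / 2 by lra.
have hk : kap * s%:R = gam * mu by rewrite divfK ?gt_eqF.
have hk' : kap * s%:R <= gam * mu by rewrite hk.
have [n1 h1] := cover_step e0' e5' m0 g0 g1 t0 k0 B2 hk'.
have [n2 h2] := sqr_le_expR (divr_gt0 (mulr_gt0 k0 e0) (ltr0n _ 16)).
set tau := 2 * gam ^+ 2 + kap / mu * (8 * gam * t%:R + 19) in h1.
have tau0 : 0 <= tau.
  have [g0' k0' m0'] := And3 (ltW g0) (ltW k0) (ltW m0).
  apply: addr_ge0; first by rewrite mulr_ge0 ?exprn_ge0.
  apply: mulr_ge0; first exact: divr_ge0.
  by rewrite addr_ge0 // mulr_ge0 // mulr_ge0.
have htau : tau <= kap * eta / 16 * s%:R.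
  have hsR : s%:R = 4 * t%:R + 19 :> R by rewrite /s natrD natrM.
  have -> : kap * eta / 16 * s%:R = 6 * gam ^+ 2.
    by rewrite /kap /gam; field; rewrite gt_eqF.
  rewrite /tau; have -> : kap / mu = gam / s%:R by rewrite /kap; field; rewrite !gt_eqF.
  have hgt : gam / s%:R * (8 * gam * t%:R + 19) <= gam / s%:R * (4 * gam * s%:R).
    apply: ler_wpM2l; first by rewrite divr_ge0 // ltW.
    rewrite hsR.
    have e96 : eta * mu = 96 * gam by rewrite /gam; field.
    by rewrite e96 in ht; lra.
  have e2 : gam / s%:R * (4 * gam * s%:R) = 4 * gam ^+ 2 by field; rewrite gt_eqF.
  by rewrite e2 in hgt; lra.
clearbody tau; clearbody kap; clearbody gam.
exists (maxn n1 (maxn n2 1)) => V H P gs; rewrite !geq_max.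
case/and3P => le1 /h2 hn2 V0 dT uP P6 sP pP fP.
set n := #|V| in le1 hn2 V0 sP *; clear h2 n2.
pose K := kap * n%:R.
have n0 : 0 < n%:R :> R by rewrite ltr0n.
have K0 : 0 < K by rewrite mulr_gt0.
have loop m Q i : (#|~: [set x in Q]| <= m)%N ->
    [/\ uniq Q, (6 <= size Q)%N, sqpath (adj H) Q & flexible H Q gs] ->
    mu * n%:R <= #|~: [set x in Q]|%:R -> (#|~: [set x in Q]| + i * s <= n)%N ->
    potential H K (~: [set x in Q]) <=
      n%:R ^+ 2 * expR (- (K * (4 / 5 + 3 / 4 * eta))) * (1 + tau) ^+ i ->
    exists P', let U := ~: [set x in P'] in
      [/\ uniq P', (6 <= size P')%N, sqpath (adj H) P' & flexible H P' gs] /\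
      [/\ dense H U (eta / 2), mu * #|V|%:R <= #|U|%:R &
        #|U|%:R <= mu * #|V|%:R + s%:R].
  elim: m Q i => [|m IHm] Q i.
    rewrite leqn0 cards_eq0 => /eqP-> _; rewrite cards0 => hm.
    by have := lt_le_trans (mulr_gt0 m0 n0) hm; rewrite ltxx.
  move=> hm [uQ Q6 sQ fQ] hmu hi hPhi; set U := ~: [set x in Q] in hm hmu hi hPhi.
  have dU : dense H U (eta / 2).
    have -> : eta / 2 = (4 / 5 + eta / 2) - 4 / 5 by lra.
    apply: (dense_of_potential K0); apply: le_trans hPhi _.
    have hi' : (1 + tau) ^+ i <= expR (kap * eta / 16 * n%:R).
      apply: le_trans (_ : expR (i%:R * tau) <= _).
        rewrite expRM_natl; apply: lerXn2r (expR_ge1Dx _); rewrite nnegrE ?addr_ge0 //.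
        exact/ltW/expR_gt0.
      rewrite ler_expR; apply: le_trans (_ : i%:R * (kap * eta / 16 * s%:R) <= _).
        by rewrite ler_wpM2l.
      have ke0 : 0 <= kap * eta / 16 by rewrite divr_ge0 // mulr_ge0 // ltW.
      rewrite mulrCA; apply: ler_wpM2l => //.
      by rewrite -natrM ler_nat (leq_trans _ hi) // leq_addl.
    apply: le_trans (_ : expR (kap * eta / 16 * n%:R) * expR (- (K * (4 / 5 + 3 / 4 * eta))) * expR (kap * eta / 16 * n%:R) <= _).
      apply: ler_pM => //.
      - by rewrite mulr_ge0 ?exprn_ge0 ?(ltW (expR_gt0 _)).
      - by rewrite exprn_ge0 // addr_ge0.
      - by rewrite ler_wpM2r // ltW // expR_gt0.
    rewrite -!expRD ler_expR /K; have : 0 <= kap * n%:R * eta by rewrite !mulr_ge0 // ltW.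
    clear; lra.
  have [small|large] := lerP #|U|%:R (mu * n%:R + s%:R); first by exists Q.
  have [P' [[uP' P6' sP' fP'] [cP' hP']]] := h1 V H Q gs le1 (ltW large) dU uQ Q6 sQ fQ.
  apply: (IHm P' i.+1) => //.
  - by rewrite -ltnS (leq_trans _ hm) // -cP' -addn1 leq_add2l /s addn_gt0 orbT.
  - move: large; rewrite -cP' natrD => /ltW; rewrite lerD2r //.
  - by rewrite mulSn addnA cP'.
  apply: le_trans hP' _; rewrite [(1 + tau) ^+ _]exprS [leRHS]mulrCA; apply: ler_wpM2l => //; exact: addr_ge0.
have cP : #|~: [set x in P]|%:R >= n%:R - (size P)%:R :> R.
  rewrite lerBlDr -natrD ler_nat /n -(cardsC [set x in P]) addnC leq_add2l.
  by rewrite cardsE card_size.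
have en : eta * n%:R <= 1 / 5 * n%:R by rewrite ler_wpM2r // ltW.
have en0 : 0 <= eta * n%:R by rewrite mulr_ge0 // ltW.
have mn : mu * n%:R <= 1 / 2 * n%:R by rewrite ler_wpM2r // ltW.
apply: (loop _ P 0%N (leqnn _)) => //; first by lra.
  by rewrite addn0 max_card.
rewrite expr0 mulr1; apply: potential_le => //.
  by rewrite -(ltr0n R); lra.
apply: (dense_subset dT); rewrite ?subsetT //; first by lra.
by rewrite cardsT -/n; lra.
Qed.

End Cover.

(** * Closing the cycle *)

Lemma min_pair_degree_le (V : finType) (H : hypergraph3 V) u v :
  u != v -> (min_pair_degree H <= #|nb H u v|)%N.
Proof.
move=> uv; rewrite card_nb // /min_pair_degree.
have := mem_index_enum (u, v); elim: index_enum => // p r IHr; rewrite inE big_cons => /predU1P[<-|/IHr h] /=.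
  by rewrite uv geq_minl.
by case: ifP => // _; apply: leq_trans (geq_minr _ _) h.
Qed.

Lemma take_rot (T : Type) k (s : seq T) i : (i < size s)%N -> (k < size s)%N ->
  take k.+1 (rot i s) = take k.+1 (drop i (s ++ take k s)).
Proof.
move=> hi hk; rewrite /rot drop_cat hi !take_cat size_drop; case: ltnP => // h.
congr (_ ++ _); rewrite take_takel ?take_takel //; lia.
Qed.

(** A triple inside four consecutive vertices omits exactly one of them, and [clique4] provides the
    edge on the other three. *)
Lemma sqpath_cycle (V : finType) (H : hypergraph3 V) (s : seq V) :
  uniq s -> (forall v, v \in s) -> (4 <= size s)%N ->
  sqpath (adj H) (s ++ take 3 s) -> squared_Hamiltonian_cycle H s.
Proof.
move=> us sV s4 ps; split=> // i e hi e3 eS.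
move: eS; rewrite (take_rot hi s4); set w := s ++ _ in ps *.
have : (4 <= size (drop i w))%N.
  by rewrite size_drop size_cat size_takel ?(ltnW s4) //; clear -hi; lia.
have := ps; rewrite -{1}(cat_take_drop i w) => /sqpath_catr.
case: (drop i w) => [|a [|b [|c [|d r]]]] // /andP[+ _] _; rewrite /= take0.
move=> /and4P[abc abd acd bcd]; have [ab ac bc] := adj_neq abc.
have [_ ad bd] := adj_neq abd; have [_ _ cd] := adj_neq acd.
have -> : [set x in [:: a; b; c; d]] = [set a; b; c; d] by apply/setP => x; rewrite !inE -!orbA.
move=> eS; have [x] : exists x, x \in [set a; b; c; d] :\: e.
  apply/card_gt0P; rewrite cardsD (setIidPr eS) e3.
  by rewrite -!setUA !cardsU1 cards1 !inE !negb_or ab ac bc ad bd cd.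
rewrite 2!inE => /andP[xe xS].
have eE (y z t : V) : adj H y z t -> e \subset [set y; z; t] -> e \in edges H.
  move=> yzt he; suff -> : e = [set y; z; t] by [].
  by apply/eqP; rewrite eqEcard he e3 (edges_card3 yzt).
have esub (y z t : V) : (forall u, u \in [set a; b; c; d] -> u != x -> u \in [set y; z; t]) -> e \subset [set y; z; t].
  move=> h; apply/subsetP => u ue; apply: h; first exact: (subsetP eS).
  by apply: contraNneq xe => <-.
move: xS; rewrite !inE -!orbA => /or4P[] /eqP ex; [apply: (eE _ _ _ bcd)|apply: (eE _ _ _ acd)|apply: (eE _ _ _ abd)|apply: (eE _ _ _ abc)];
  apply: esub => u; rewrite ex !inE; do !case: (u == _) => //.
Qed.

Theorem theorem1p1 (R : realType) (alpha : R) (alpha_gt0 : 0 < alpha) :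
  exists n0 : nat, forall (V : finType) (H : hypergraph3 V),
    (n0 <= #|V|)%N ->
    (4%:R / 5%:R + alpha) * #|V|%:R <= (min_pair_degree H)%:R ->
    has_squared_Hamiltonian_cycle H.
Proof.
pose eta := Num.min alpha (1 / 5).
have e0 : 0 < eta by rewrite lt_min alpha_gt0 divr_gt0.
have e5 : eta <= 1 / 5 by rewrite ge_min lexx orbT.
have ea : eta <= alpha by rewrite ge_min lexx.
clearbody eta; have e0' : 0 < eta / 2 by rewrite divr_gt0.
have e5' : eta / 2 <= 1 / 5 by lra.
have [q [n1 [q0 h1]]] := absorbing_path e0 e5.
have q0R : 0 < q%:R :> R by rewrite ltr0n.
have q1R : 1 <= q%:R :> R by rewrite ler1n.
(* About [n / (2 * q)] vertices will remain, half of the absorbing capacity [n %/ q]; the spare half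
   pays for [s] and for rounding. *)
pose mu : R := (2 * q%:R)^-1.
have m0 : 0 < mu by rewrite invr_gt0 mulr_gt0.
have m1 : mu <= 1 / 2 by rewrite div1r lef_pV2 ?posrE ?mulr_gt0 // ler_peMr.
have [s [n2 h2]] := almost_cover e0 e5 m0 m1.
have [n3 h3] := connect_paths e0' e5' m0.
exists (maxn n1 (maxn n2 (maxn n3 (2 * q * s.+1)))) => V H; rewrite !geq_max.
case/and4P => le1 le2 le3 le4 hdeg.
have dT : dense H setT eta.
  move=> u v uv; rewrite setTI cardsT.
  apply: (@le_trans _ _ (min_pair_degree H)%:R); last by rewrite ler_nat min_pair_degree_le.
  by apply: le_trans hdeg; rewrite ler_wpM2r // lerD2l.
have [P0 [gs [[uP0 P06 sP0 pP0 fP0] hgs]]] := h1 V H le1 dT.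
have [P [[uP P6 pP fP] [dU muU Umu]]] := h2 V H P0 gs le2 dT uP0 P06 sP0 pP0 fP0.
set U := ~: _ in dU muU Umu.
have P4 : (4 <= size P)%N by apply: leq_trans P6.
have P3 := ltnW P4.
(* The path is to be connected to itself; its two end triples are disjoint because it has at least
   six vertices. *)
have uends : uniq (last3 P ++ take 3 P).
  have -> : last3 P = last3 (drop 3 P) by rewrite -{1}(cat_take_drop 3 P) cat_last3 // size_drop leq_subRL.
  rewrite -[take 3 P](take_takel _ (leqnn 3)); apply: uniq_last3_take3.
  by rewrite uniq_catC cat_take_drop.
have [p [p19 up pU spp]] := h3 V H U le3 muU dU P P P4 P4 pP pP uends.
pose X := enum (U :\: [set x in p]).
have hX : (size X <= #|V| %/ q)%N.
  rewrite -cardE; apply: leq_trans (subset_leq_card (subsetDl _ _)) _.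
  rewrite -(ler_nat R); apply: le_trans Umu _.
  have h4 : #|V|%:R <= (#|V| %/ q)%:R * q%:R + q%:R :> R.
    by rewrite -natrM -natrD ler_nat addnC -mulSn ltnW // ltn_ceil.
  have h5 : 2 * q%:R * (s%:R + 1) <= #|V|%:R :> R.
    by rewrite natr1 -!natrM ler_nat.
  rewrite -(ler_pM2r q0R) mulrDl; have -> : mu * #|V|%:R * q%:R = #|V|%:R / 2.
    by rewrite /mu; field; rewrite gt_eqF.
  clear -h4 h5; lra.
(* Absorbing the rest keeps both end triples, so [p] still closes the cycle. *)
have [c [pc sc c3 lc3]] := absorb fP hgs hX.
have sizec := perm_size3 P3 pc.
have hc x : (x \in c) = (x \in P) || (x \in X) by rewrite (perm_mem pc) mem_cat.
have XE x : (x \in X) = (x \notin p) && (x \notin P) by rewrite mem_enum !inE.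
have uc : uniq c.
  rewrite (perm_uniq pc) cat_uniq uP enum_uniq andbT; apply/hasPn => x.
  by rewrite XE => /andP[].
have upc : uniq (c ++ p).
  rewrite cat_uniq uc up andbT; apply/hasPn => x xp; rewrite hc XE xp /= orbF.
  by have := pU x xp; rewrite !inE.
have allc v : v \in c ++ p by rewrite mem_cat hc XE; case: (v \in p); case: (v \in P).
have sizecp : (5 <= size (c ++ p))%N by rewrite size_cat p19 (leq_trans _ (leq_addl _ _)).
split; first by rewrite -(card_uniqP upc) in sizecp; apply: leq_trans sizecp (max_card _).
exists (c ++ p); apply: sqpath_cycle => //; first exact: ltnW.
rewrite takel_cat // -catA; apply: sqpath_join => //.
- by rewrite size_takel.
- by apply: (@sqpath_catl _ _ _ (drop 3 c)); rewrite cat_take_drop.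
- by rewrite take_takel // lc3 c3.
Qed.
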